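(* For every joint discrete distribution $p_{UV}$, $$\mathcal{S}_{\mathrm{dig}}(p_{UV})\cup\mathcal{S}_{\mathrm{ana}}(p_{UV})\subseteq\mathcal{S}(p_{UV}),$$ and the inclusion is strict for some $p_{UV}$. Moreover, $\mathcal{S}(p_{UV})$ is strictly larger than $\mathcal{S}_{\mathrm{ana}}(p_{UV})$ if and only if $C_{\mathsf{GK}}(U;V)>0$.
   Context: Let $(U,V)\sim p_{UV}$. The Gács–Körner common information is $C_{\mathsf{GK}}(U;V)=\max H(f(U))$ over all pairs of functions $f,g$ with $\Pr(f(U)=g(V))=1$; the maximizing random variable $K=f(U)=g(V)$ (unique up to relabeling) is the GK common part. The Wyner common information is $C_{\mathsf{W}}(X;Y)=\min_{W:\,X-W-Y}I(X,Y;W)$, the minimum being over $W$ such that $X-W-Y$ is a Markov chain. $A-B-C-D$ being a Markov chain means $p(a,b,c,d)=p(a,b)p(c|b)p(d|c)$. The three collections of joint discrete distributions $p_{XY}$ (on arbitrary alphabets) are: - $\mathcal{S}_{\mathrm{dig}}(p_{UV})$ (digital scheme): all $p_{XY}$ with $C_{\mathsf{GK}}(U;V)\ge C_{\mathsf{W}}(X;Y)$. - $\mathcal{S}_{\mathrm{ana}}(p_{UV})$ (analog scheme): all $p_{XY}$ for which there is a Markov chain $X-U-V-Y$ with $(U,V)\sim p_{UV}$ and $(X,Y)\sim p_{XY}$. - $\mathcal{S}(p_{UV})$ (hybrid scheme): all $p_{XY}$ for which there exist $W,X,Y$ jointly distributed with $(U,V)\sim p_{UV}$ and with $(X,Y)\sim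 p_{XY}$, such that $W-K-(U,V)$ and $X-(U,W)-(V,W)-Y$ are Markov chains and $C_{\mathsf{GK}}(U;V)\ge I(X,Y;K,W)$. *)

(* Defs.v *)
From HB Require Import structures.
From mathcomp Require Import all_boot all_order all_algebra.
From mathcomp Require Import all_classical all_reals all_analysis.

Set Implicit Arguments.
Unset Strict Implicit.
Unset Printing Implicit Defensive.

Import Order.TTheory GRing.Theory Num.Theory.

Local Open Scope classical_set_scope.
Local Open Scope ring_scope.
Local Open Scope ereal_scope.

(* "Discrete" means finite or countably infinite; entropies and mutual
   informations therefore live in \bar R and may be +oo. *)
Record distr (R : realType) (T : countType) := Distr {
  prob_of :> T -> R;
  prob_of_ge0 : forall t, (0 <= prob_of t)%R;
  prob_of_sum1 : \esum_(t in [set: T]) (prob_of t)%:E = 1 }.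

Section RandomVariables.
Variables (R : realType) (Om : countType) (P : distr R Om).

Definition Pr (E : set Om) : \bar R := \esum_(w in E) (P w)%:E.

Definition law (A : countType) (X : Om -> A) (a : A) : R :=
  fine (Pr (X @^-1` [set a])).

Definition has_law (A : countType) (X : Om -> A) (q : distr R A) : Prop :=
  forall a, law X a = q a.

Definition joint (A B : countType) (X : Om -> A) (Y : Om -> B) : Om -> A * B :=
  fun w => (X w, Y w).

(* p(b|a), with value 0 when p(a) = 0 *)
Definition cond_law (A B : countType) (X : Om -> A) (Y : Om -> B)
    (b : B) (a : A) : R :=
  (law (joint X Y) (a, b) / law X a)%R.

(* Entropy in nats: the base of the logarithm is immaterial as long as it is
   the same everywhere. Since ln 0 = 0, null atoms contribute 0. *)
Definition entropy (A : countType) (X : Om -> A) : \bar R :=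
  \esum_(a in [set: A]) (- (law X a * ln (law X a)))%:E.

Definition mutual_info_term (A B : countType) (X : Om -> A) (Y : Om -> B)
    (z : A * B) : \bar R :=
  (law (joint X Y) z *
     ln (law (joint X Y) z / (law X z.1 * law Y z.2)))%:E.

(* \esum is meant for nonnegative terms, hence the split into positive and
   negative parts. The negative parts always have a finite sum, because
   p ln (p / q) >= p - q, so the difference is never +oo - +oo. *)
Definition mutual_info (A B : countType) (X : Om -> A) (Y : Om -> B) : \bar R :=
  \esum_(z in [set: A * B]) (mutual_info_term X Y)^\+ z -
  \esum_(z in [set: A * B]) (mutual_info_term X Y)^\- z.

Definition markov3 (A B C : countType)
    (X : Om -> A) (Y : Om -> B) (Z : Om -> C) : Prop :=
  forall a b c,
    law (joint (joint X Y) Z) (a, b, c) =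
    (law (joint X Y) (a, b) * cond_law Y Z c b)%R.

Definition markov4 (A B C D : countType)
    (X : Om -> A) (Y : Om -> B) (Z : Om -> C) (T : Om -> D) : Prop :=
  forall a b c d,
    law (joint (joint (joint X Y) Z) T) (a, b, c, d) =
    (law (joint X Y) (a, b) * cond_law Y Z c b * cond_law Z T d c)%R.

End RandomVariables.

Section CommonInformation.
Variable R : realType.

Definition common_pair (U V C : countType) (p : distr R (U * V)%type)
    (f : U -> C) (g : V -> C) : Prop :=
  Pr p [set z | f z.1 = g z.2] = 1.

(* The supremum is in fact a maximum, possibly equal to +oo. *)
Definition C_GK (U V : countType) (p : distr R (U * V)%type) : \bar R :=
  ereal_sup [set h | exists (C : countType) (f : U -> C) (g : V -> C),
    common_pair p f g /\ h = entropy p (fun z => f z.1)].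

Definition is_GK_part (U V C : countType) (p : distr R (U * V)%type)
    (f : U -> C) (g : V -> C) : Prop :=
  common_pair p f g /\ entropy p (fun z => f z.1) = C_GK p.

Definition wyner_values (A B : countType) (q : distr R (A * B)%type) :
    set (\bar R) :=
  [set i | exists (Om : countType) (P : distr R Om) (D : countType)
      (X : Om -> A) (Y : Om -> B) (W : Om -> D),
    [/\ has_law P (joint X Y) q,
        markov3 P X W Y &
        i = mutual_info P (joint X Y) W]].

(* A relation, since on infinite alphabets the infimum over discrete W need
   not be attained; on finite alphabets the minimum always exists. *)
Definition is_C_W (A B : countType) (q : distr R (A * B)%type) (c : \bar R) :
    Prop :=
  wyner_values q c /\ lbound (wyner_values q) c.

End CommonInformation.

(* A collection of joint distributions p_XY, over all pairs of alphabets. *)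
Definition collection (R : realType) :=
  forall A B : countType, distr R (A * B)%type -> Prop.

Definition cunion (R : realType) (S T : collection R) : collection R :=
  fun A B q => S A B q \/ T A B q.

Definition csub (R : realType) (S T : collection R) : Prop :=
  forall (A B : countType) (q : distr R (A * B)%type), S A B q -> T A B q.

Definition cproper (R : realType) (S T : collection R) : Prop :=
  csub S T /\
  exists (A B : countType) (q : distr R (A * B)%type), T A B q /\ ~ S A B q.

Section Schemes.
Variables (R : realType) (U V : countType) (p : distr R (U * V)%type).

Definition S_dig : collection R := fun A B q =>
  exists c, is_C_W q c /\ C_GK p >= c.

Definition S_ana : collection R := fun A B q =>
  exists (Om : countType) (P : distr R Om)
    (U' : Om -> U) (V' : Om -> V) (X : Om -> A) (Y : Om -> B),
  [/\ has_law P (joint U' V') p,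
      has_law P (joint X Y) q &
      markov4 P X U' V' Y].

(* When C_GK p is finite the common part K is unique up to relabeling. When
   it is +oo a maximizing pair (f, g) need not be the finest common function,
   but since W - K - (U, V) is only weakened by refining K, and the bound on
   the mutual information is then vacuous, quantifying existentially over the
   maximizers gives the same collection as taking the finest one. *)
Definition S_hyb : collection R := fun A B q =>
  exists (C : countType) (f : U -> C) (g : V -> C), is_GK_part p f g /\
  exists (Om : countType) (P : distr R Om) (D : countType)
    (U' : Om -> U) (V' : Om -> V) (W : Om -> D) (X : Om -> A) (Y : Om -> B),
  let K := fun w => f (U' w) in
  [/\ has_law P (joint U' V') p,
      has_law P (joint X Y) q,
      markov3 P W K (joint U' V'),
      markov4 P X (joint U' W) (joint V' W) Y &
      C_GK p >= mutual_info P (joint X Y) (joint K W)].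

End Schemes.

(* Main.v *)
(* Entropies and mutual informations are compared pointwise on the sample space:
   the expectation of [f (X w)] is the sum of [law X a * f a], and all lower
   bounds come from [p ln (p / q) >= p - q + (sqrt p - sqrt q)^2].

   The finest common part [K] of [(U, V)] identifies two values of [U] exactly
   when every common function does.  A digital scheme becomes hybrid by making
   [(X, Y, W)] independent of [(U, V)], and an analog one by making [W]
   constant.  If [(X, Y)] is analog, every common function of [X] and [Y] has
   the law of a function of [K].  So, when [H(K) > 0], a source [X = Y] whose
   entropy is [H(K)] but whose law is not that of a relabeling of [K] is hybrid
   and not analog.  When [H(K) = 0] the pair [(X, Y)] is independent of [W], and
   conditioning on one value of [W] leaves an analog scheme.

   For the strict inclusion, [U = (K, U1)] and [V = (K, V1)] with [K] a fair bit
   and [(U1, V1)] uniform on the pairs of distinct elements of a set of size 3,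
   while [X = (B, U1)] and [Y = (B, V1)] with [B] independent, ternary, and of
   entropy [ln 2]: then [B] is not a function of [K], and
   [C_W(X; Y) >= I(X; Y) = ln 2 + ln (3 / 2) > C_GK(U; V)]. *)

Require Import Defs.
From mathcomp Require Import all_boot all_order all_algebra.
From mathcomp Require Import all_classical all_reals all_analysis.
From mathcomp Require Import ring lra.

Set Implicit Arguments.
Unset Strict Implicit.
Unset Printing Implicit Defensive.

Import Order.TTheory GRing.Theory Num.Theory.
Import numFieldNormedType.Exports.

Local Open Scope classical_set_scope.
Local Open Scope ring_scope.
Local Open Scope ereal_scope.

Lemma esumZl (R : realType) (T : choiceType) (D : set T) (f : T -> \bar R)
    (c : R) : (0 <= c)%R -> (forall t, 0 <= f t) ->
  \esum_(t in D) (c%:E * f t) = c%:E * \esum_(t in D) f t.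
Proof.
move=> c0 f0; rewrite /esum -ereal_supZl//; last first.
  by apply/set0P; exists (\sum_(t \in set0) f t), set0 => //; exact: fsets_set0.
congr ereal_sup; apply/seteqP; split => x [X XD <-].
  by exists (\sum_(t \in X) f t); [exists X|rewrite ge0_mule_fsumr].
by case: XD => Y YD <-; exists Y => //; rewrite ge0_mule_fsumr.
Qed.

Lemma esum_prod (R : realType) (S T : choiceType) (f : S * T -> \bar R) :
  (forall z, 0 <= f z) ->
  \esum_(z in [set: S * T]) f z =
  \esum_(s in [set: S]) \esum_(t in [set: T]) f (s, t).
Proof.
move=> f0; rewrite (@esum_esum _ _ _ _ (fun=> setT) (fun s t => f (s, t)))//.
rewrite (_ : _ `*`` _ = setT); first by apply: eq_esum => -[].
by apply/seteqP; split.
Qed.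

Lemma esum_prod_mul (R : realType) (S T : choiceType) (f : S -> R)
    (g : T -> R) :
  (forall s, 0 <= f s)%R -> (forall t, 0 <= g t)%R ->
  \esum_(t in [set: T]) (g t)%:E = 1 ->
  \esum_(z in [set: S * T]) (f z.1 * g z.2)%:E = \esum_(s in [set: S]) (f s)%:E.
Proof.
move=> f0 g0 g1; rewrite esum_prod => [|z]; last by rewrite lee_fin mulr_ge0.
apply: eq_esum => s _ /=.
under eq_esum do rewrite EFinM.
by rewrite esumZl// ?g1 ?mule1// => t; rewrite lee_fin.
Qed.

Lemma esum_pos_neg_ge (R : realType) (T : choiceType) (t u v : T -> R) :
  (forall z, 0 <= u z)%R -> (forall z, 0 <= v z)%R ->
  (forall z, u z - v z <= t z)%R ->
  \esum_(z in [set: T]) (v z)%:E < +oo ->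
  \esum_(z in [set: T]) (u z)%:E - \esum_(z in [set: T]) (v z)%:E <=
  \esum_(z in [set: T]) (EFin \o t)^\+ z -
  \esum_(z in [set: T]) (EFin \o t)^\- z.
Proof.
move=> u0 v0 uvt voo.
have vfin : \esum_(z in [set: T]) (v z)%:E \is a fin_num.
  by rewrite ge0_fin_numE// esum_ge0// => z _; rewrite lee_fin.
have nfin : \esum_(z in [set: T]) (EFin \o t)^\- z \is a fin_num.
  rewrite ge0_fin_numE ?esum_ge0// (le_lt_trans _ voo)//.
  apply: le_esum => z _; rewrite funenegE /= -EFin_max lee_fin ge_max v0 andbT.
  by have := uvt z; have := u0 z; lra.
rewrite leeBlDr// -addeA (addeC (- _)) addeA leeBrDr//.
rewrite -!esumD//; try by move=> z _; rewrite lee_fin.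
apply: le_esum => z _; rewrite funeposE funenegE /= -!EFin_max -!EFinD lee_fin.
by have := uvt z; rewrite /Num.max; do 2 case: ifP; lra.
Qed.

Definition expect (R : realType) (T : countType) (P : distr R T) (f : T -> R) :
    \bar R := \esum_(t in [set: T]) (P t * f t)%:E.

Section Laws.
Variables (R : realType) (Om : countType) (P : distr R Om).

Let P0 w : 0 <= (P w)%:E. Proof. by rewrite lee_fin prob_of_ge0. Qed.

Lemma Pr_ge0 E : 0 <= Pr P E. Proof. exact: esum_ge0. Qed.

Lemma PrE E : Pr P E = expect P (fun w => (w \in E)%:R)%R.
Proof.
rewrite /Pr esum_mkcond; apply: eq_esum => w _.
by case: ifP; rewrite ?mulr1 ?mulr0.
Qed.

Lemma Pr_le1 E : Pr P E <= 1.
Proof.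
rewrite PrE -(prob_of_sum1 P); apply: le_esum => w _; rewrite lee_fin.
by rewrite ler_piMr ?prob_of_ge0// lern1; case: (_ \in _).
Qed.

Lemma Pr_fin E : Pr P E \is a fin_num.
Proof. by rewrite ge0_fin_numE ?Pr_ge0// (le_lt_trans (Pr_le1 E)) ?ltry. Qed.

Lemma le_expect f g : (forall w, P w != 0 -> f w <= g w)%R ->
  expect P f <= expect P g.
Proof.
move=> fg; apply: le_esum => w _; rewrite lee_fin.
have [->|Pw] := eqVneq (P w) 0%R; first by rewrite !mul0r.
by rewrite ler_wpM2l ?prob_of_ge0// fg.
Qed.

Lemma eq_expect f g : (forall w, P w != 0 -> f w = g w)%R ->
  expect P f = expect P g.
Proof.
by move=> fg; apply/eqP; rewrite eq_le !le_expect// => w Pw; rewrite fg.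
Qed.

Lemma expect_ge0 f : (forall w, P w != 0 -> 0 <= f w)%R -> 0 <= expect P f.
Proof.
move=> f0; apply: esum_ge0 => w _; rewrite lee_fin.
have [->|Pw] := eqVneq (P w) 0%R; first by rewrite !mul0r.
by rewrite mulr_ge0 ?prob_of_ge0// f0.
Qed.

Lemma expectD f g : (forall w, 0 <= f w)%R -> (forall w, 0 <= g w)%R ->
  expect P (fun w => f w + g w)%R = expect P f + expect P g.
Proof.
move=> f0 g0; rewrite /expect -esumD; first last.
- by move=> w _; rewrite lee_fin mulr_ge0 ?prob_of_ge0.
- by move=> w _; rewrite lee_fin mulr_ge0 ?prob_of_ge0.
by apply: eq_esum => w _; rewrite mulrDr EFinD.
Qed.

Lemma expect_cst (c : R) : (0 <= c)%R -> expect P (fun=> c) = c%:E.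
Proof.
move=> c0; rewrite /expect; under eq_esum do rewrite mulrC EFinM.
by rewrite esumZl// prob_of_sum1 mule1.
Qed.

Section Law.
Variables (A : countType) (X : Om -> A).

Lemma lawE a : (law P X a)%:E = Pr P (X @^-1` [set a]).
Proof. by rewrite /law fineK ?Pr_fin. Qed.

Lemma law_expect a : (law P X a)%:E = expect P (fun w => (X w == a)%:R)%R.
Proof.
rewrite lawE PrE; apply: eq_expect => w _; congr (nat_of_bool _)%:R%R.
by apply/idP/eqP; rewrite inE.
Qed.

Lemma law_ge0 a : (0 <= law P X a)%R.
Proof. by rewrite -lee_fin lawE Pr_ge0. Qed.

Lemma law_le1 a : (law P X a <= 1)%R.
Proof. by rewrite -lee_fin lawE Pr_le1. Qed.

Lemma expect_law (f : A -> R) : (forall a, 0 <= f a)%R ->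
  expect P (f \o X) = \esum_(a in [set: A]) (law P X a * f a)%:E.
Proof.
move=> f0.
transitivity (\esum_(a in [set: A]) \esum_(w in X @^-1` [set a])
    (P w * f (X w))%:E).
  rewrite esum_esum => [|a w _ _]; last first.
    by rewrite lee_fin mulr_ge0 ?prob_of_ge0.
  rewrite (@reindex_esum _ _ _ setT _ (fun w => (X w, w)))//; split => //=.
    by move=> v w _ _ [].
  by move=> [a w] /= [_ <-]; exists w.
apply: eq_esum => a _; rewrite mulrC EFinM lawE -esumZl//.
by apply: eq_esum => w /= <-; rewrite mulrC EFinM.
Qed.

Lemma sum_law : \esum_(a in [set: A]) (law P X a)%:E = 1.
Proof.
rewrite -(expect_cst (@ler01 R)) (_ : (fun=> _) = (fun=> 1%R) \o X)//.
by rewrite expect_law//; apply: eq_esum => a _; rewrite mulr1.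
Qed.

Lemma law_gt0 w : P w != 0%R -> (0 < law P X (X w))%R.
Proof.
move=> Pw; rewrite -lte_fin lawE /Pr (esumID [set w])//.
rewrite (_ : _ `&` _ = [set w]); last by apply/seteqP; split => [x []|x ->].
by rewrite esum_set1// lte_paddr// ?esum_ge0// lte_fin lt0r Pw prob_of_ge0.
Qed.

Lemma law_neq0 a : law P X a != 0%R -> exists w, P w != 0%R /\ X w = a.
Proof.
move=> la; apply: contrapT => /forallNP h; move/eqP: la; apply.
apply: EFin_inj; rewrite law_expect; apply: esum1 => w _.
case: eqP => [Xw|]; last by rewrite mulr0.
by case: (eqVneq (P w) 0%R) => [->|Pw]; [rewrite mul0r|have := h w; case].
Qed.

Lemma law_eq0 a : (forall w, P w != 0%R -> X w <> a) -> law P X a = 0%R.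
Proof.
by move=> h; apply/eqP/negPn/negP => /law_neq0 [w [/h]].
Qed.

End Law.

Lemma le_law (A B : countType) (X : Om -> A) (Y : Om -> B) a b :
  (forall w, P w != 0%R -> X w = a -> Y w = b) -> (law P X a <= law P Y b)%R.
Proof.
move=> XY; rewrite -lee_fin !law_expect; apply: le_expect => w Pw.
by case: eqP => [/(XY _ Pw)->|_]; rewrite ?eqxx// ler0n.
Qed.

Lemma eq_law (A B : countType) (X : Om -> A) (Y : Om -> B) a b :
  (forall w, P w != 0%R -> X w = a <-> Y w = b) -> law P X a = law P Y b.
Proof.
by move=> XY; apply/eqP; rewrite eq_le !le_law// => w Pw /(XY w Pw).
Qed.

Lemma law_joint_marginal (A B : countType) (X : Om -> A) (Y : Om -> B) a :
  \esum_(b in [set: B]) (law P (joint X Y) (a, b))%:E = (law P X a)%:E.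
Proof.
rewrite law_expect.
transitivity (expect P ((fun z : A * B => (z.1 == a)%:R)%R \o joint X Y)) => //.
rewrite expect_law// esum_prod => [|z]; last first.
  by rewrite lee_fin mulr_ge0// law_ge0.
rewrite (esumID [set a]); last first.
  by move=> *; apply: esum_ge0 => ? _; rewrite lee_fin mulr_ge0// law_ge0.
rewrite setTI esum_set1; last first.
  by apply: esum_ge0 => ? _; rewrite lee_fin mulr_ge0// law_ge0.
rewrite [X in _ + X]esum1 ?adde0 => [|i [_ /= /eqP/negPf ia]]; last first.
  by apply: esum1 => b _; rewrite ia mulr0.
by apply: eq_esum => b _ /=; rewrite eqxx mulr1.
Qed.

Lemma Pr_eq1 E : Pr P E = 1 <-> (forall w, P w != 0%R -> E w).
Proof.
split=> [PE1 w Pw|h]; last first.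
  rewrite PrE -(expect_cst (@ler01 R)); apply: eq_expect => w /h Ew.
  by rewrite mem_set.
apply: contrapT => nEw; suff : 1 < 1 :> \bar R by rewrite ltxx.
rewrite -{2}(prob_of_sum1 P) (esumID E)// !setTI -/(Pr P E) PE1 lteDl//.
rewrite (esumID [set w])// (_ : _ `&` _ = [set w]); last first.
  by apply/seteqP; split => [x []|x ->].
by rewrite esum_set1// lte_paddr// ?esum_ge0// lte_fin lt0r Pw prob_of_ge0.
Qed.

End Laws.

Section Entropy.
Variables (R : realType) (Om : countType) (P : distr R Om).

Lemma expect_eq0 (f : Om -> R) : (forall w, P w != 0 -> 0 <= f w)%R ->
  expect P f <= 0 -> forall w, P w != 0%R -> f w = 0%R.
Proof.
move=> f0 Ef w Pw; have Pf v : 0 <= (P v * f v)%:E.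
  rewrite lee_fin; have [->|Pv] := eqVneq (P v) 0%R; first by rewrite mul0r.
  by rewrite mulr_ge0 ?prob_of_ge0 ?f0.
apply/eqP; rewrite eq_le f0// andbT -(@pmulr_rle0 _ (P w)); last first.
  by rewrite lt0r Pw prob_of_ge0.
rewrite -lee_fin (le_trans _ Ef)// /expect (esumID [set w])//.
rewrite setTI esum_set1// leeDl//; exact: esum_ge0.
Qed.

Lemma expect_le_eq (f g : Om -> R) :
  (forall w, 0 <= f w)%R -> (forall w, P w != 0 -> f w <= g w)%R ->
  expect P g <= expect P f -> expect P f < +oo ->
  forall w, P w != 0%R -> f w = g w.
Proof.
move=> f0 fg gf foo w Pw.
have {gf} : expect P f + expect P (fun v => Num.max (g v - f v) 0)%R <=
    expect P f.
  rewrite -expectD//; last by move=> v; rewrite le_max lexx orbT.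
  apply: le_trans gf; apply: le_expect => v /fg; rewrite -subr_ge0 => fgv.
  by rewrite max_l// addrC subrK.
have Efin : expect P f \is a fin_num by rewrite ge0_fin_numE// expect_ge0.
rewrite -leeBrDl// subee// => E0.
have := expect_eq0 _ E0 Pw; rewrite max_l ?subr_ge0 ?fg//.
move=> h; apply/esym/eqP; rewrite -subr_eq0 h// => v _.
by rewrite le_max lexx orbT.
Qed.

Lemma entropyE (A : countType) (X : Om -> A) :
  entropy P X = expect P (fun w => - ln (law P X (X w)))%R.
Proof.
rewrite (_ : (fun _ => _) = (fun a => - ln (law P X a))%R \o X)//.
rewrite expect_law => [|a]; last by rewrite oppr_ge0 ln_le0// law_le1.
by apply: eq_esum => a _; rewrite mulrN.
Qed.

Lemma entropy_ge0 (A : countType) (X : Om -> A) : 0 <= entropy P X.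
Proof.
by rewrite entropyE expect_ge0// => w _; rewrite oppr_ge0 ln_le0// law_le1.
Qed.

Lemma law_comp_ge (A B : countType) (X : Om -> A) (h : A -> B) a :
  (law P X a <= law P (h \o X) (h a))%R.
Proof. by apply: le_law => w _ /= ->. Qed.

Lemma le_lnN (x y : R) : (0 < x -> x <= y -> - ln y <= - ln x)%R.
Proof.
by move=> x0 xy; rewrite lerN2 ler_ln// posrE//; exact: lt_le_trans xy.
Qed.

Lemma entropy_comp_le (A B : countType) (X : Om -> A) (h : A -> B) :
  entropy P (h \o X) <= entropy P X.
Proof.
rewrite !entropyE; apply: le_expect => w Pw.
by rewrite le_lnN ?law_gt0// law_comp_ge.
Qed.

Lemma entropy_comp_inj (A B : countType) (X : Om -> A) (h : A -> B) :
  entropy P X < +oo -> entropy P X <= entropy P (h \o X) ->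
  forall a a', law P X a != 0%R -> law P X a' != 0%R -> h a = h a' -> a = a'.
Proof.
move=> Xoo hX a a' la la' haa'; apply/eqP/negPn/negP => aa'.
have [w [Pw Xw]] := law_neq0 la.
have : (law P (h \o X) (h a) = law P X a)%R.
  apply: ln_inj; rewrite ?posrE.
  - by have := law_gt0 (h \o X) Pw; rewrite /= Xw.
  - by have := law_gt0 X Pw; rewrite /= Xw.
  rewrite !entropyE in hX; apply/oppr_inj; rewrite -Xw.
  apply: (expect_le_eq _ _ hX _ Pw) => [v|v Pv|].
  - by rewrite oppr_ge0 ln_le0// law_le1.
  - by rewrite le_lnN ?law_gt0// law_comp_ge.
  - by rewrite -entropyE (le_lt_trans _ Xoo)// entropy_comp_le.
apply/eqP; rewrite gt_eqF// (@lt_le_trans _ _ (law P X a + law P X a')%R)//.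
  by rewrite ltrDl lt0r la' law_ge0.
rewrite -lee_fin EFinD !law_expect -expectD//.
apply: le_expect => v _; case: (eqVneq (X v) a) => [e|].
  by rewrite /= e (negPf aa') addr0 eqxx.
by case: (eqVneq (X v) a') => [e _|]; rewrite /= ?e add0r ?haa' ?eqxx// ler0n.
Qed.

End Entropy.

Section HasLaw.
Variables (R : realType) (Om : countType) (P : distr R Om).
Variables (A : countType) (Z : Om -> A) (q : distr R A).
Hypothesis Zq : has_law P Z q.

Lemma expect_has_law (f : A -> R) : (forall a, 0 <= f a)%R ->
  expect P (f \o Z) = expect q f.
Proof.
by move=> f0; rewrite expect_law//; apply: eq_esum => a _; rewrite Zq.
Qed.

Lemma law_has_law (B : countType) (h : A -> B) b :
  law P (h \o Z) b = law q h b.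
Proof.
apply: EFin_inj; rewrite !law_expect.
by rewrite -(expect_has_law (f := fun a => (h a == b)%:R%R)).
Qed.

Lemma entropy_has_law (B : countType) (h : A -> B) :
  entropy P (h \o Z) = entropy q h.
Proof. by apply: eq_esum => b _; rewrite law_has_law. Qed.

Lemma has_law_neq0 w : P w != 0%R -> q (Z w) != 0%R.
Proof. by rewrite -Zq => /(law_gt0 Z) /lt0r_neq0. Qed.

Lemma has_law_neq0_ex a : q a != 0%R -> exists w, P w != 0%R /\ Z w = a.
Proof. by rewrite -Zq => /law_neq0. Qed.

End HasLaw.

Section Gibbs.
Variable R : realType.
Implicit Types p q x : R.
Local Open Scope ring_scope.

Lemma ln_le_sub1 x : 0 < x -> ln x <= x - 1.
Proof.
move=> x0; rewrite -{1}(subrK 1 x) addrC le_ln1Dx//.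
by rewrite ltrBrDr addNr.
Qed.

(* [p ln (p / q) = - 2 p ln (sqrt q / sqrt p)], then [ln y <= y - 1]. *)
Lemma gibbs_sqrt p q : 0 <= p -> 0 <= q -> (q = 0 -> p = 0) ->
  p - q + (Num.sqrt p - Num.sqrt q) ^+ 2 <= p * ln (p / q).
Proof.
move=> p0 q0 qp; have [pE|pN] := eqVneq p 0.
  by rewrite pE mul0r sqrtr0 !sub0r sqrrN sqr_sqrtr// addNr.
have [/qp/eqP|qN] := eqVneq q 0; first by rewrite (negPf pN).
have sp : 0 < Num.sqrt p by rewrite sqrtr_gt0 lt0r pN.
have sq : 0 < Num.sqrt q by rewrite sqrtr_gt0 lt0r qN.
set a := Num.sqrt p in sp *; set b := Num.sqrt q in sq *.
have <- : a ^+ 2 = p by rewrite sqr_sqrtr.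
have <- : b ^+ 2 = q by rewrite sqr_sqrtr.
have -> : a ^+ 2 / b ^+ 2 = ((b / a) ^+ 2)^-1.
  by rewrite -[RHS]exprVn invf_div expr_div_n.
rewrite lnV ?posrE ?exprn_gt0 ?divr_gt0// lnXn ?divr_gt0//.
have := ln_le_sub1 (divr_gt0 sq sp); set l := ln _ => hl.
have : a ^+ 2 * l <= a ^+ 2 * (b / a - 1) by rewrite ler_pM2l ?exprn_gt0.
have -> : a ^+ 2 * (b / a - 1) = a * b - a ^+ 2 by field; exact: lt0r_neq0.
by rewrite mulrN mulrnAr; nra.
Qed.

Lemma gibbs p q : 0 <= p -> 0 <= q -> (q = 0 -> p = 0) ->
  p - q <= p * ln (p / q).
Proof.
move=> p0 q0 /(gibbs_sqrt p0 q0); apply: le_trans.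
by rewrite lerDl sqr_ge0.
Qed.

End Gibbs.

Section MutualInformation.
Variables (R : realType) (Om : countType) (P : distr R Om).

Section Pair.
Variables (A B : countType) (X : Om -> A) (Y : Om -> B).

Lemma law_joint_lel a b : (law P (joint X Y) (a, b) <= law P X a)%R.
Proof. by apply: le_law => w _ []. Qed.

Lemma law_joint_ler a b : (law P (joint X Y) (a, b) <= law P Y b)%R.
Proof. by apply: le_law => w _ []. Qed.

Lemma law_jointC a b : law P (joint X Y) (a, b) = law P (joint Y X) (b, a).
Proof. by apply: eq_law => w _; split=> -[<- <-]. Qed.

Lemma law_joint_marginalr b :
  \esum_(a in [set: A]) (law P (joint X Y) (a, b))%:E = (law P Y b)%:E.
Proof.
by under eq_esum do rewrite law_jointC; rewrite law_joint_marginal.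
Qed.

Lemma law_joint_eq0l a b : law P X a = 0%R -> law P (joint X Y) (a, b) = 0%R.
Proof.
by move=> Xa; apply/eqP; rewrite eq_le law_ge0 andbT -Xa law_joint_lel.
Qed.

Lemma law_joint_eq0r a b : law P Y b = 0%R -> law P (joint X Y) (a, b) = 0%R.
Proof.
by move=> Xa; apply/eqP; rewrite eq_le law_ge0 andbT -Xa law_joint_ler.
Qed.

Lemma mutual_info_le_entropy : mutual_info P X Y <= entropy P Y.
Proof.
rewrite /mutual_info (@le_trans _ _
  (\esum_(z in setT) (mutual_info_term P X Y)^\+ z))//.
  by rewrite -[leRHS]sube0 leeB// esum_ge0.
rewrite entropyE (_ : (fun _ => _) =
  (fun z : A * B => - ln (law P Y z.2))%R \o joint X Y)//.
have l0 b : (0 <= - ln (law P Y b))%R by rewrite oppr_ge0 ln_le0// law_le1.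
rewrite expect_law//; apply: le_esum => -[a b] _.
rewrite funeposE ge_max !lee_fin mulr_ge0 ?law_ge0// andbT /=.
have [->|lab] := eqVneq (law P (joint X Y) (a, b)) 0%R; first by rewrite !mul0r.
rewrite ler_wpM2l ?law_ge0//.
have lab0 : (0 < law P (joint X Y) (a, b))%R by rewrite lt0r lab law_ge0.
have la0 : (0 < law P X a)%R by rewrite (lt_le_trans lab0) ?law_joint_lel.
have lb0 : (0 < law P Y b)%R by rewrite (lt_le_trans lab0) ?law_joint_ler.
rewrite -lnV ?posrE// ler_ln ?posrE ?divr_gt0 ?mulr_gt0 ?invr_gt0//.
rewrite invfM mulrA ler_piMl ?invr_ge0 ?law_ge0// ler_pdivrMr//.
by rewrite mul1r law_joint_lel.
Qed.

Lemma mutual_info_indep : mutual_info P X Y <= 0 ->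
  forall a b, law P (joint X Y) (a, b) = (law P X a * law P Y b)%R.
Proof.
pose pXY z := law P (joint X Y) z; pose pp z := (law P X z.1 * law P Y z.2)%R.
pose d z : R := ((Num.sqrt (pXY z) - Num.sqrt (pp z)) ^+ 2)%R.
have pp0 z : (0 <= pp z)%R by rewrite mulr_ge0 ?law_ge0.
have d0 z : (0 <= d z)%R by exact: sqr_ge0.
have pp1 : \esum_(z in [set: A * B]) (pp z)%:E = 1.
  by rewrite esum_prod_mul ?sum_law// => *; rewrite law_ge0.
have pXY1 : \esum_(z in [set: A * B]) (pXY z)%:E = 1 by exact: sum_law.
move=> I0; have : \esum_(z in [set: A * B]) (d z)%:E <= 0.
  apply: le_trans I0; apply: le_trans (esum_pos_neg_ge
      (u := (fun z => pXY z + d z)%R) (v := pp) _ _ _ _).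
  - rewrite pp1 (eq_esum (b := fun z => (pXY z)%:E + (d z)%:E))//.
    rewrite esumD; [|by move=> z _; rewrite lee_fin law_ge0|
      by move=> z _; rewrite lee_fin].
    by rewrite pXY1 addeAC subee// add0e.
  - by move=> z; rewrite addr_ge0 ?law_ge0.
  - by [].
  - move=> [a b]; rewrite addrAC gibbs_sqrt ?law_ge0//.
    move=> /eqP; rewrite mulf_eq0 => /orP[]/eqP; first exact: law_joint_eq0l.
    exact: law_joint_eq0r.
  - by rewrite pp1 ltry.
move=> dle a b; have : (d (a, b) <= 0)%R.
  rewrite -lee_fin (le_trans _ dle)// (esumID [set (a, b)]).
    rewrite setTI esum_set1 ?lee_fin// leeDl// esum_ge0// => z _.
    by rewrite lee_fin.
  by move=> z _; rewrite lee_fin.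
rewrite le_eqVlt ltNge d0 orbF sqrf_eq0 subr_eq0 eqr_sqrt// ?law_ge0//.
by move/eqP.
Qed.

End Pair.

Lemma mutual_info_indep_pair (A B C : countType)
    (X : Om -> A) (Y : Om -> B) (Z : Om -> C) :
  (forall a b c, law P (joint X (joint Z Y)) (a, (c, b)) =
    law P Z c * law P (joint X Y) (a, b))%R ->
  mutual_info P X (joint Z Y) = mutual_info P X Y.
Proof.
move=> ind.
have indZY c b : law P (joint Z Y) (c, b) = (law P Z c * law P Y b)%R.
  apply: EFin_inj; rewrite -(law_joint_marginalr X) EFinM.
  rewrite -(law_joint_marginalr X Y).
  rewrite -esumZl ?law_ge0//; last by move=> *; rewrite lee_fin law_ge0.
  by apply: eq_esum => a _; rewrite ind.
pose e z : A * (C * B) := (z.1.1, (z.2, z.1.2)).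
have be : set_bij [set: A * B * C] [set: A * (C * B)] e.
  split => // [[[a b] c] [[a' b'] c'] _ _ [-> -> ->]//|[a [c b]] _].
  by exists (a, b, c).
have tE z : mutual_info_term P X (joint Z Y) (e z) =
    (law P Z z.2)%:E * mutual_info_term P X Y z.1.
  case: z => -[a b] c; rewrite /e /mutual_info_term/= -EFinM ind indZY.
  have [->|lc] := eqVneq (law P Z c) 0%R; first by rewrite !mul0r.
  by rewrite mulrCA -mulf_div divff// mul1r mulrA.
have sumK (t : A * B -> R) : (forall z, 0 <= t z)%R ->
    \esum_(z in [set: A * B * C]) (t z.1 * law P Z z.2)%:E =
    \esum_(z in [set: A * B]) (t z)%:E.
  by move=> t0; apply: (esum_prod_mul t0 _ (sum_law P Z)) => c; exact: law_ge0.
have maxM (x y : R) : (0 <= y -> Num.max (y * x) 0 = Num.max x 0 * y)%R.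
  by move=> y0; rewrite -{1}(mulr0 y) -maxr_pMr// mulrC.
pose t z := fine (mutual_info_term P X Y z).
have termE z : mutual_info_term P X Y z = (t z)%:E by [].
rewrite /mutual_info !(@reindex_esum _ _ _ _ _ e _ be); congr (_ - _).
- rewrite (eq_esum (b := fun z => (Num.max (t z.1) 0 * law P Z z.2)%:E)).
    rewrite (sumK (fun z => Num.max (t z) 0)%R) => [|z]; last first.
      by rewrite le_max lexx orbT.
    by apply: eq_esum => z _; rewrite funeposE termE EFin_max.
  by move=> z _; rewrite funeposE tE termE -EFinM -EFin_max maxM ?law_ge0.
- rewrite (eq_esum (b := fun z => (Num.max (- t z.1) 0 * law P Z z.2)%:E)).
    rewrite (sumK (fun z => Num.max (- t z) 0)%R) => [|z]; last first.
      by rewrite le_max lexx orbT.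
    by apply: eq_esum => z _; rewrite funenegE termE EFin_max.
  move=> z _; rewrite funenegE tE termE -EFinM -EFinN -mulrN -EFin_max.
  by rewrite maxM ?law_ge0.
Qed.

(* [I(X,Y;Z) - I(X;Y) = I(Y;Z|X) + I(X;Z|Y)], and each conditional mutual
   information is the divergence of [p(x,y,z)] from [r1] and [r2]. *)
Lemma mutual_info_markov3_ge (A B C : countType)
    (X : Om -> A) (Y : Om -> B) (Z : Om -> C) (f : A * B -> R) :
  markov3 P X Z Y -> (forall z, 0 <= f z)%R ->
  (forall a b, law P (joint X Y) (a, b) != 0 ->
    f (a, b) <= ln (law P (joint X Y) (a, b) / (law P X a * law P Y b)))%R ->
  expect P (f \o joint X Y) <= mutual_info P (joint X Y) Z.
Proof.
move=> XZY f0 f_le.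
pose p z := law P (joint (joint X Y) Z) z.
pose r1 z := (law P (joint X Y) z.1 * law P (joint X Z) (z.1.1, z.2) /
  law P X z.1.1)%R.
pose r2 z := (law P (joint X Y) z.1 * law P (joint Y Z) (z.1.2, z.2) /
  law P Y z.1.2)%R.
have r10 z : (0 <= r1 z)%R by rewrite !mulr_ge0 ?invr_ge0 ?law_ge0.
have r20 z : (0 <= r2 z)%R by rewrite !mulr_ge0 ?invr_ge0 ?law_ge0.
have p0 z : (0 <= p z)%R by exact: law_ge0.
have r_le1 (D : countType) (S : Om -> D) (s : A * B -> D) :
    (forall z, law P (joint X Y) z <= law P S (s z))%R ->
    \esum_(z in [set: A * B * C]) (law P (joint X Y) z.1 *
      law P (joint S Z) (s z.1, z.2) / law P S (s z.1))%:E <= 1.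
  move=> XYS; rewrite esum_prod => [|z]; last first.
    by rewrite lee_fin !mulr_ge0 ?invr_ge0 ?law_ge0.
  rewrite -[leRHS](sum_law P (joint X Y)); apply: le_esum => z _ /=.
  under eq_esum do rewrite mulrAC EFinM.
  rewrite esumZl ?mulr_ge0 ?invr_ge0 ?law_ge0//; last first.
    by move=> c; rewrite lee_fin law_ge0.
  rewrite law_joint_marginal -EFinM lee_fin.
  have [->|lS] := eqVneq (law P S (s z)) 0%R; first by rewrite mulr0 law_ge0.
  by rewrite divfK.
have sum_r : \esum_(z in [set: A * B * C]) (r1 z + r2 z)%:E <= 2%:R%:E.
  rewrite (eq_esum (b := fun z => (r1 z)%:E + (r2 z)%:E))// esumD.
  - rewrite (_ : 2%:R%:E = 1 + 1)// leeD//.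
      by apply: (r_le1 _ X fst) => -[a b]; exact: law_joint_lel.
    by apply: (r_le1 _ Y snd) => -[a b]; exact: law_joint_ler.
  - by move=> z _; rewrite lee_fin.
  - by move=> z _; rewrite lee_fin.
pose u z := (p z * f z.1 + p z * 2)%R.
have sum_u : \esum_(z in [set: A * B * C]) (u z)%:E =
    expect P (f \o joint X Y) + 2%:R%:E.
  transitivity (expect P ((fun z => f z.1 + 2)%R \o joint (joint X Y) Z)).
    rewrite expect_law => [|z]; last by rewrite addr_ge0.
    by apply: eq_esum => z _; rewrite /u -mulrDr.
  rewrite -(expect_cst P (ler0n R 2)) -expectD// => w; exact: f0.
apply: (@le_trans _ _ (\esum_(z in [set: A * B * C]) (u z)%:E -
    \esum_(z in [set: A * B * C]) (r1 z + r2 z)%:E)).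
  rewrite sum_u leeBrDr ?leeD2l// ge0_fin_numE ?(le_lt_trans sum_r) ?ltry//.
  by apply: esum_ge0 => z _; rewrite lee_fin addr_ge0.
apply: esum_pos_neg_ge.
- by move=> z; rewrite addr_ge0// mulr_ge0// f0.
- by move=> z; rewrite addr_ge0.
- move=> [[a b] c]; rewrite /u -/(p _).
  have [pz|pN] := eqVneq (p (a, b, c)) 0%R.
    by rewrite pz !mul0r addr0 sub0r oppr_le0 addr_ge0.
  have pgt : (0 < p (a, b, c))%R by rewrite lt0r pN p0.
  have pxyE : (p (a, b, c) <= law P (joint X Y) (a, b))%R.
    exact: law_joint_lel.
  have pxzE : (p (a, b, c) <= law P (joint X Z) (a, c))%R.
    by apply: le_law => w _ [<- _ <-].
  have pyzE : (p (a, b, c) <= law P (joint Y Z) (b, c))%R.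
    by apply: le_law => w _ [_ <- <-].
  have pz0 : (0 < law P Z c)%R := lt_le_trans pgt (law_joint_ler _ _ _ _).
  have px0 : (0 < law P X a)%R.
    exact: lt_le_trans (lt_le_trans pgt pxyE) (law_joint_lel _ _ _ _).
  have py0 : (0 < law P Y b)%R.
    exact: lt_le_trans (lt_le_trans pgt pxyE) (law_joint_ler _ _ _ _).
  have pM : p (a, b, c) = (law P (joint X Z) (a, c) * law P (joint Y Z) (b, c) /
      law P Z c)%R.
    have := XZY a c b; rewrite /cond_law (law_jointC Z) mulrA => <-.
    by apply: eq_law => w _; split=> -[<- <- <-].
  have := lt_le_trans pgt pxyE; have := lt_le_trans pgt pxzE.
  have := lt_le_trans pgt pyzE; rewrite /= => pyz0 pxz0 pxy0.
  have r1gt : (0 < r1 (a, b, c))%R by rewrite divr_gt0 ?mulr_gt0.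
  have r2gt : (0 < r2 (a, b, c))%R by rewrite divr_gt0 ?mulr_gt0.
  have g1 : (p (a, b, c) - r1 (a, b, c) <=
      p (a, b, c) * ln (p (a, b, c) / r1 (a, b, c)))%R.
    by apply: gibbs; rewrite ?ltW// => r10'; rewrite r10' ltxx in r1gt.
  have g2 : (p (a, b, c) - r2 (a, b, c) <=
      p (a, b, c) * ln (p (a, b, c) / r2 (a, b, c)))%R.
    by apply: gibbs; rewrite ?ltW// => r20'; rewrite r20' ltxx in r2gt.
  have pf : (p (a, b, c) * f (a, b) <= p (a, b, c) *
      ln (law P (joint X Y) (a, b) / (law P X a * law P Y b)))%R.
    by rewrite ler_pM2l// f_le// lt0r_neq0.
  rewrite -/(p (a, b, c)) /=.
  have -> : (p (a, b, c) / (law P (joint X Y) (a, b) * law P Z c) =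
      law P (joint X Y) (a, b) / (law P X a * law P Y b) *
      (p (a, b, c) / r1 (a, b, c)) * (p (a, b, c) / r2 (a, b, c)))%R.
    rewrite [in RHS]pM /r1 /r2 /= pM; field.
    by rewrite !lt0r_neq0.
  have lnM3 (x y z : R) : (0 < x -> 0 < y -> 0 < z ->
      ln (x * y * z) = ln x + ln y + ln z)%R.
    by move=> x0 y0 z0; rewrite !lnM ?posrE ?mulr_gt0.
  rewrite lnM3 ?divr_gt0 ?mulr_gt0// !mulrDr.
  apply: le_trans (lerD (lerD pf g1) g2).
  by rewrite le_eqVlt; apply/orP; left; apply/eqP; ring.
- by rewrite (le_lt_trans sum_r) ?ltry.
Qed.

End MutualInformation.

Section Constructions.
Variable R : realType.

Lemma law_id (S : countType) (P : distr R S) s : law P id s = P s.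
Proof. by rewrite /law /Pr esum_set1// lee_fin prob_of_ge0. Qed.

Definition push_distr (S A : countType) (P : distr R S) (X : S -> A) :
  distr R A := Distr (law_ge0 P X) (sum_law P X).

Lemma has_law_push (S A : countType) (P : distr R S) (X : S -> A) :
  has_law P X (push_distr P X).
Proof. by []. Qed.

Section Product.
Variables (S T : countType) (P : distr R S) (Q : distr R T).

Lemma prod_distr_ge0 z : (0 <= P z.1 * Q z.2)%R.
Proof. by rewrite mulr_ge0 ?prob_of_ge0. Qed.

Lemma prod_distr_sum1 : \esum_(z in [set: S * T]) (P z.1 * Q z.2)%:E = 1.
Proof.
rewrite (esum_prod_mul (f := P) (g := Q)) ?prob_of_sum1// => t;
  exact: prob_of_ge0.
Qed.

Definition prod_distr := Distr prod_distr_ge0 prod_distr_sum1.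

Lemma law_prod (A B : countType) (X : S -> A) (Y : T -> B) a b :
  law prod_distr (joint (X \o fst) (Y \o snd)) (a, b) =
  (law P X a * law Q Y b)%R.
Proof.
apply: EFin_inj; rewrite law_expect /expect esum_prod => [|z]; last first.
  by rewrite lee_fin mulr_ge0 ?prob_of_ge0.
transitivity (\esum_(s in [set: S])
    ((law Q Y b)%:E * (P s * (X s == a)%:R)%:E)).
  apply: eq_esum => s _; rewrite muleC law_expect -esumZl//; first last.
  - by move=> t; rewrite lee_fin mulr_ge0 ?prob_of_ge0.
  - by rewrite mulr_ge0 ?prob_of_ge0.
  apply: eq_esum => t _; rewrite /joint /= xpair_eqE -mulnb natrM.
  by rewrite -EFinM; congr EFin; ring.
rewrite esumZl ?law_ge0//; first by rewrite EFinM muleC (law_expect P).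
by move=> s; rewrite lee_fin mulr_ge0 ?prob_of_ge0.
Qed.

Lemma law_prod_fst (A : countType) (X : S -> A) a :
  law prod_distr (X \o fst) a = law P X a.
Proof.
apply: EFin_inj; rewrite -(law_joint_marginal _ _ (id \o snd)).
rewrite (eq_esum (b := fun t => (law P X a)%:E * (law Q id t)%:E)).
  rewrite esumZl ?law_ge0 ?sum_law ?mule1// => t.
  by rewrite lee_fin law_ge0.
by move=> t _; rewrite -EFinM; congr EFin; exact: law_prod.
Qed.

Lemma law_prod_snd (B : countType) (Y : T -> B) b :
  law prod_distr (Y \o snd) b = law Q Y b.
Proof.
apply: EFin_inj; rewrite -(law_joint_marginalr _ (id \o fst)).
rewrite (eq_esum (b := fun t => (law Q Y b)%:E * (law P id t)%:E)).
  rewrite esumZl ?law_ge0 ?sum_law ?mule1// => t.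
  by rewrite lee_fin law_ge0.
by move=> t _; rewrite -EFinM mulrC; congr EFin; exact: law_prod.
Qed.

End Product.

Section Conditioning.
Variables (Om D : countType) (P : distr R Om) (W : Om -> D) (d : D).
Hypothesis Wd : law P W d != 0%R.

Lemma cond_distr_ge0 w : (0 <= (law P W d)^-1 * (P w * (W w == d)%:R))%R.
Proof. by rewrite !mulr_ge0 ?invr_ge0 ?law_ge0 ?prob_of_ge0. Qed.

Lemma esum_cond (b : Om -> bool) :
  \esum_(w in [set: Om])
    ((law P W d)^-1 * (P w * (W w == d)%:R) * (b w)%:R)%:E =
  ((law P W d)^-1)%:E * expect P (fun w => ((W w == d) && b w)%:R)%R.
Proof.
rewrite -esumZl ?invr_ge0 ?law_ge0//; last first.
  by move=> w; rewrite lee_fin mulr_ge0 ?prob_of_ge0.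
by apply: eq_esum => w _; rewrite -EFinM -mulnb natrM !mulrA.
Qed.

Lemma cond_distr_sum1 :
  \esum_(w in [set: Om]) ((law P W d)^-1 * (P w * (W w == d)%:R))%:E = 1.
Proof.
transitivity ((law P W d)^-1 * law P W d)%:E; last by rewrite mulVf.
rewrite EFinM law_expect.
rewrite (eq_expect (g := (fun w => ((W w == d) && true)%:R)%R)).
  by rewrite -(esum_cond (fun=> true)); apply: eq_esum => w _; rewrite /= mulr1.
by move=> w _; rewrite andbT.
Qed.

Definition cond_distr := Distr cond_distr_ge0 cond_distr_sum1.

Lemma law_cond (A : countType) (X : Om -> A) a :
  law cond_distr X a = (law P (joint X W) (a, d) / law P W d)%R.
Proof.
apply: EFin_inj; rewrite law_expect /expect esum_cond mulrC EFinM law_expect.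
congr (_ * _); apply: eq_expect => w _.
by rewrite /joint xpair_eqE andbC.
Qed.

End Conditioning.
End Constructions.

Lemma esum_finType (R : realType) (T : finType) (f : T -> R) :
  (forall t, 0 <= f t)%R ->
  \esum_(t in [set: T]) (f t)%:E = (\sum_t f t)%:E.
Proof.
move=> f0.
rewrite (eq_esum (b := fun t => \sum_(s : T) (if t == s then f s else 0)%:E)).
  rewrite esum_sum => [|i j _ _]; last by case: ifP; rewrite ?lee_fin.
  rewrite -sumEFin; apply: eq_bigr => s _; rewrite (esumID [set s]).
    rewrite setTI esum_set1 eqxx ?lee_fin// esum1 ?adde0// => t [_ /=].
    by move=> /eqP/negPf ->.
  by move=> t _; case: ifP; rewrite ?lee_fin.
move=> t _; rewrite (bigD1 t)//= eqxx big1 ?adde0// => s /negPf st.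
by rewrite eq_sym st.
Qed.

Lemma distr_neq0 (R : realType) (Om : countType) (P : distr R Om) :
  exists w, P w != 0%R.
Proof.
apply: contrapT => /forallNP P0; have := prob_of_sum1 P.
rewrite esum1 => [/esym/eqP|w _]; first by rewrite onee_eq0.
by have := P0 w; case: eqVneq => [->|_ /(_ isT)].
Qed.

Section GacsKorner.
Variables (R : realType) (U V : countType) (p : distr R (U * V)%type).

Lemma common_pairP (C : countType) (f : U -> C) (g : V -> C) :
  common_pair p f g <-> (forall u v, p (u, v) != 0%R -> f u = g v).
Proof.
rewrite /common_pair Pr_eq1; split=> [h u v /h//|h [u v] /h//].
Qed.

Definition finest_pair (C : countType) (f : U -> C) (g : V -> C) : Prop :=
  common_pair p f g /\
  forall (C' : countType) (f' : U -> C') (g' : V -> C'),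
    common_pair p f' g' -> exists h, f' =1 h \o f.

Lemma finest_pair_exists :
  exists (f : U -> U) (g : V -> U), finest_pair f g.
Proof.
pose eqv u u' := `[< forall (C : countType) (f : U -> C) (g : V -> C),
  common_pair p f g -> f u = f u' >].
have eqv_refl u : eqv u u by apply/asboolP.
have [[u0 _] _] := distr_neq0 p.
pose f u := choose (eqv u) u.
pose g v := f (xget u0 [set u | p (u, v) != 0%R]).
exists f, g; split=> [|C f' g' fg'].
  apply/common_pairP => u v puv; rewrite /g.
  set u' := xget _ _; have pu'v : p (u', v) != 0%R.
    by apply: (@xgetPex _ u0 [set u | p (u, v) != 0%R]); exists u.
  have uu' w : eqv u w = eqv u' w.
    have e (C : countType) (h : U -> C) (k : V -> C) :
      common_pair p h k -> h u = h u'.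
      by move=> /common_pairP hk; rewrite (hk _ _ puv) (hk _ _ pu'v).
    by apply/idP/idP => /asboolP H; apply/asboolP => C h k hk;
      rewrite -(H _ _ _ hk) (e _ _ _ hk).
  rewrite /f (eq_choose uu'); apply: choose_id; last exact: eqv_refl.
  by rewrite -uu' eqv_refl.
exists f' => u /=; have : eqv u (f u) by exact: chooseP.
by move=> /asboolP H; exact: H fg'.
Qed.

Lemma finest_GK_part (C : countType) (f : U -> C) (g : V -> C) :
  finest_pair f g -> is_GK_part p f g.
Proof.
move=> [fg fin]; split=> //; apply/eqP; rewrite eq_le; apply/andP; split.
  by apply: ereal_sup_ubound; exists C, f, g.
apply: ge_ereal_sup => _ [C' [f' [g' [fg' ->]]]]; have [h hE] := fin _ _ _ fg'.
rewrite (_ : (fun z => f' z.1) = h \o (fun z => f z.1)) ?entropy_comp_le//.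
by apply/funext => z; rewrite hE.
Qed.

Lemma C_GK_ge0 : 0 <= C_GK p.
Proof.
have [f [g /finest_GK_part [_ <-]]] := finest_pair_exists.
exact: entropy_ge0.
Qed.

End GacsKorner.

Lemma eq_mutual_info (R : realType) (Om Om' A B : countType) (P : distr R Om)
    (Q : distr R Om') (X : Om -> A) (Y : Om -> B)
    (X' : Om' -> A) (Y' : Om' -> B) :
  law P X =1 law Q X' -> law P Y =1 law Q Y' ->
  law P (joint X Y) =1 law Q (joint X' Y') ->
  mutual_info P X Y = mutual_info Q X' Y'.
Proof.
move=> eX eY eXY; rewrite /mutual_info.
rewrite (_ : mutual_info_term P X Y = mutual_info_term Q X' Y')//.
by apply/funext => z; rewrite /mutual_info_term eX eY eXY.
Qed.

Section Independence.
Variables (R : realType) (Om : countType) (P : distr R Om).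

Lemma law_indep_comp (A B A' B' : countType) (X : Om -> A) (Y : Om -> B)
    (g : A -> A') (h : B -> B') :
  (forall a b, law P (joint X Y) (a, b) = law P X a * law P Y b)%R ->
  forall a b, law P (joint (g \o X) (h \o Y)) (a, b) =
    (law P (g \o X) a * law P (h \o Y) b)%R.
Proof.
move=> ind a b.
have XY : has_law P (joint X Y) (prod_distr (push_distr P X) (push_distr P Y)).
  by move=> [a' b'].
have /= -> := law_has_law (has_law_push P X) g a.
have /= -> := law_has_law (has_law_push P Y) h b.
rewrite -law_prod -(law_has_law XY).
by apply: eq_law.
Qed.

Lemma markov3_indep (A B C : countType) (W : Om -> A) (Z : Om -> B)
    (h : B -> C) :
  (forall a b, law P (joint W Z) (a, b) = law P W a * law P Z b)%R ->
  markov3 P W (h \o Z) Z.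
Proof.
move=> ind w k z; rewrite /cond_law.
rewrite (law_indep_comp id h ind).
have -> : law P (joint (joint W (h \o Z)) Z) (w, k, z) =
    (law P W w * law P (joint (h \o Z) Z) (k, z))%R.
  rewrite -(law_indep_comp id (fun z => (h z, z)) ind).
  by apply: eq_law => v _; split=> [[<- <- <-]|[<- <- <-]].
have [k0|kN] := eqVneq (law P (h \o Z) k) 0%R; last by field.
by rewrite law_joint_eq0l// k0 !(mul0r, mulr0).
Qed.

End Independence.

Section ProductMarkov.
Variables (R : realType) (S T : countType) (P : distr R S) (Q : distr R T).
Let PQ := prod_distr P Q.

Lemma mutual_info_prod (A C D : countType) (X : T -> A) (K : S -> C)
    (W : T -> D) :
  mutual_info PQ (X \o snd) (joint (K \o fst) (W \o snd)) = mutual_info Q X W.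
Proof.
rewrite mutual_info_indep_pair => [|a w k].
  by apply: eq_mutual_info => z; exact: law_prod_snd.
rewrite (@eq_law _ _ _ _ _ _
  (joint (K \o fst) (joint X W \o snd)) _ (k, (a, w))).
  rewrite law_prod; congr (_ * _)%R; first by rewrite -(law_prod_fst P Q).
  by rewrite -(law_prod_snd P Q).
by move=> s _; split=> -[<- <- <-].
Qed.

Lemma markov4_prod (A B C D E : countType) (U : S -> A) (V : S -> B)
    (X : T -> C) (W : T -> D) (Y : T -> E) : markov3 Q X W Y ->
  markov4 PQ (X \o snd) (joint (U \o fst) (W \o snd))
    (joint (V \o fst) (W \o snd)) (Y \o snd).
Proof.
move=> XWY x [u w] [v w'] y; rewrite /cond_law.
have [<-|ww'] := eqVneq w w'; last first.
  rewrite law_eq0 => [|s _ [_ _ e1 _ e2 _]]; last first.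
    by rewrite -e1 -e2 eqxx in ww'.
  rewrite [law PQ (joint (joint (U \o fst) _) (joint _ _)) _]law_eq0.
    by rewrite mul0r mulr0 mul0r.
  by move=> s _ [_ e1 _ e2]; rewrite -e1 -e2 eqxx in ww'.
have -> : law PQ (joint (joint (joint (X \o snd) (joint (U \o fst) (W \o snd)))
      (joint (V \o fst) (W \o snd))) (Y \o snd)) (x, (u, w), (v, w), y) =
    law PQ (joint (joint U V \o fst) (joint (joint X W) Y \o snd))
      ((u, v), (x, w, y)).
  by apply: eq_law => s _; split=> [[<- <- <- <- _ <-]|[<- <- <- <- <-]].
have -> : law PQ (joint (X \o snd) (joint (U \o fst) (W \o snd))) (x, (u, w)) =
    law PQ (joint (U \o fst) (joint X W \o snd)) (u, (x, w)).
  by apply: eq_law => s _; split=> [[<- <- <-]|[<- <- <-]].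
have -> : law PQ (joint (joint (U \o fst) (W \o snd))
      (joint (V \o fst) (W \o snd))) ((u, w), (v, w)) =
    law PQ (joint (joint U V \o fst) (W \o snd)) ((u, v), w).
  by apply: eq_law => s _; split=> [[<- <- <- _]|[<- <- <-]].
have -> : law PQ (joint (joint (V \o fst) (W \o snd)) (Y \o snd)) ((v, w), y) =
    law PQ (joint (V \o fst) (joint W Y \o snd)) (v, (w, y)).
  by apply: eq_law => s _; split=> [[<- <- <-]|[<- <- <-]].
rewrite !law_prod XWY /cond_law.
have [w0|wN] := eqVneq (law Q W w) 0%R.
  by rewrite [law Q (joint X W) _]law_joint_eq0r// !(mul0r, mulr0).
have [u0|uN] := eqVneq (law P U u) 0%R.
  by rewrite law_joint_eq0l// u0 !(mul0r, mulr0).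
have [v0|vN] := eqVneq (law P V v) 0%R.
  by rewrite law_joint_eq0r// v0 !(mul0r, mulr0).
by field; rewrite wN uN vN.
Qed.

End ProductMarkov.

Lemma markov4_det (R : realType) (Om A B C D : countType) (P : distr R Om)
    (U : Om -> A) (V : Om -> B) (h : A -> C) (k : B -> D) :
  markov4 P (h \o U) U V (k \o V).
Proof.
move=> x u v y; rewrite /cond_law.
have [<-|hu] := eqVneq (h u) x; last first.
  rewrite law_eq0 => [|s _ [e1 e2 _ _]]; last by rewrite -e1 e2 eqxx in hu.
  rewrite [law P (joint (h \o U) U) _]law_eq0 => [|s _ [e1 e2]]; last first.
    by rewrite -e1 /= e2 eqxx in hu.
  by rewrite !mul0r.
have [<-|kv] := eqVneq (k v) y; last first.
  rewrite law_eq0 => [|s _ [_ _ e1 e2]]; last by rewrite -e2 e1 eqxx in kv.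
  rewrite [law P (joint V (k \o V)) _]law_eq0 => [|s _ [e1 e2]]; last first.
    by rewrite -e2 /= e1 eqxx in kv.
  by rewrite mul0r mulr0.
have -> : law P (joint (joint (joint (h \o U) U) V) (k \o V)) (h u, u, v, k v) =
    law P (joint U V) (u, v).
  by apply: eq_law => s _; split=> [[_ <- <-]|[<- <-]].
have -> : law P (joint (h \o U) U) (h u, u) = law P U u.
  by apply: eq_law => s _; split=> [[_ <-]|<-].
have -> : law P (joint V (k \o V)) (v, k v) = law P V v.
  by apply: eq_law => s _; split=> [[<-]|<-].
have [u0|uN] := eqVneq (law P U u) 0%R.
  by rewrite law_joint_eq0l// u0 !mul0r.
have [v0|vN] := eqVneq (law P V v) 0%R.
  by rewrite law_joint_eq0r// !(mul0r, mulr0).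
by field; rewrite uN vN.
Qed.

Section Inclusions.
Variables (R : realType) (U V : countType) (p : distr R (U * V)%type).

Lemma S_hyb_indep (A B : countType) (q : distr R (A * B)%type)
    (Om D : countType) (Q : distr R Om)
    (X : Om -> A) (Y : Om -> B) (W : Om -> D) :
  has_law Q (joint X Y) q -> markov3 Q X W Y ->
  mutual_info Q (joint X Y) W <= C_GK p -> S_hyb p q.
Proof.
move=> XYq XWY Ile.
have [f [g /finest_GK_part fg]] := finest_pair_exists p.
exists U, f, g; split=> //.
exists _, (prod_distr p Q), D, (fst \o fst), (snd \o fst), (W \o snd),
  (X \o snd), (Y \o snd); split.
- move=> a; rewrite -[RHS]law_id -(law_prod_fst p Q).
  by apply: eq_law => -[[? ?] ?].
- by move=> a; rewrite -XYq -(law_prod_snd p Q).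
- apply: (@markov3_indep _ _ (prod_distr p Q) _ _ _ (W \o snd)
    (joint (fst \o fst) (snd \o fst)) (f \o fst)) => w z.
  have -> : joint (fst \o fst) (snd \o fst) = id \o @fst (U * V) Om.
    by apply/funext => -[[? ?] ?].
  by rewrite law_jointC law_prod law_prod_fst law_prod_snd mulrC.
- exact: (markov4_prod p fst snd XWY).
- by rewrite (mutual_info_prod p Q (joint X Y) (f \o fst) W).
Qed.

Lemma S_dig_sub_hyb : csub (S_dig p) (S_hyb p).
Proof.
move=> A B q [_ [[[Om [P [D [X [Y [W [XYq XWY ->]]]]]]] _] Ile]].
exact: S_hyb_indep XYq XWY Ile.
Qed.

Lemma S_ana_sub_hyb : csub (S_ana p) (S_hyb p).
Proof.
move=> A B q [Om [P [U' [V' [X [Y [UVp XYq XUVY]]]]]]].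
have [f [g /finest_GK_part fg]] := finest_pair_exists p.
exists U, f, g; split=> //.
exists _, P, unit, U', V', (fun=> tt), X, Y; split=> //.
- move=> [] k uv; rewrite /cond_law.
  set K := fun w => f (U' w).
  have -> : law P (joint (joint (fun=> tt) K) (joint U' V')) (tt, k, uv) =
      law P (joint K (joint U' V')) (k, uv).
    by apply: eq_law => w _; split=> [[<- <-]|[<- <-]].
  have -> : law P (joint (fun=> tt) K) (tt, k) = law P K k.
    by apply: eq_law => w _; split=> [[<-]|<-].
  have [k0|kN] := eqVneq (law P K k) 0%R; last by field.
  by rewrite law_joint_eq0l// k0 !mul0r.
- move=> x [u []] [v []] y; rewrite /cond_law.
  have -> : law P (joint (joint (joint X (joint U' (fun=> tt)))
      (joint V' (fun=> tt))) Y) (x, (u, tt), (v, tt), y) =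
      law P (joint (joint (joint X U') V') Y) (x, u, v, y).
    by apply: eq_law => w _; split=> [[<- <- <- <-]|[<- <- <- <-]].
  rewrite XUVY /cond_law; congr (_ * (_ / _) * (_ / _))%R;
    apply: eq_law => w _.
  + by split=> [[<- <-]|[<- <-]].
  + by split=> [[<- <-]|[<- <-]].
  + by split=> [<-|[<-]].
  + by split=> [[<- <-]|[<- <-]].
  + by split=> [<-|[<-]].
- apply: le_trans (mutual_info_le_entropy _ _ _) _.
  rewrite -fg.2 -(entropy_has_law UVp).
  exact: (entropy_comp_le _ _ (fun k => (k, tt))).
Qed.

End Inclusions.

Section CommonPart.
Variables (R : realType) (U V : countType) (p : distr R (U * V)%type).

(* Given [(U, V) = (u, v)] the variables [X] and [Y] are independent, so
   [a X = b Y] forces [a X] to be constant, and that constant is determined by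
   [u] alone as well as by [v] alone. *)
Lemma S_ana_common_pair (A B C : countType) (q : distr R (A * B)%type)
    (a : A -> C) (b : B -> C) : S_ana p q -> common_pair q a b ->
  exists (f : U -> C) (g : V -> C), common_pair p f g /\
    law p (f \o fst) =1 law q (a \o fst).
Proof.
move=> [Om [P [U' [V' [X [Y [UVp XYq XUVY]]]]]]] /common_pairP ab.
have [w0 _] := distr_neq0 P.
pose f u := a (X (xget w0 [set w | P w != 0%R /\ U' w = u])).
pose g v := b (Y (xget w0 [set w | P w != 0%R /\ V' w = v])).
have key x u v y : law P (joint X U') (x, u) != 0%R -> p (u, v) != 0%R ->
    law P (joint V' Y) (v, y) != 0%R -> a x = b y.
  rewrite -UVp => xu uv vy; apply: ab; rewrite -XYq.
  have : law P (joint (joint (joint X U') V') Y) (x, u, v, y) != 0%R.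
    rewrite XUVY /cond_law !mulf_neq0 ?invr_neq0//.
      by apply: contra_neq uv => /law_joint_eq0l.
    by apply: contra_neq vy => /law_joint_eq0l.
  apply: contra_neq => xy0; apply/eqP; rewrite eq_le law_ge0 andbT -xy0.
  by apply: le_law => w _ [<- _ _ <-].
have lawN (T S : countType) (X1 : Om -> T) (X2 : Om -> S) w : P w != 0%R ->
    law P (joint X1 X2) (X1 w, X2 w) != 0%R.
  by move=> Pw; rewrite lt0r_neq0// (law_gt0 (joint X1 X2) Pw).
have fP w : P w != 0%R -> exists x,
    f (U' w) = a x /\ law P (joint X U') (x, U' w) != 0%R.
  move=> Pw; have [Pw' e] := @xgetPex _ w0
    [set v | P v != 0%R /\ U' v = U' w] (ex_intro _ w (conj Pw erefl)).
  by eexists; split; [reflexivity|have := lawN _ _ X U' _ Pw'; rewrite e].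
have gP w : P w != 0%R -> exists y,
    g (V' w) = b y /\ law P (joint V' Y) (V' w, y) != 0%R.
  move=> Pw; have [Pw' e] := @xgetPex _ w0
    [set v | P v != 0%R /\ V' v = V' w] (ex_intro _ w (conj Pw erefl)).
  by eexists; split; [reflexivity|have := lawN _ _ V' Y _ Pw'; rewrite e].
exists f, g; split.
  apply/common_pairP => u v puv.
  have [w [Pw [wu wv]]] := has_law_neq0_ex UVp puv; rewrite -wu -wv in puv *.
  have [x [-> xu]] := fP _ Pw; have [y [-> vy]] := gP _ Pw.
  exact: key xu puv vy.
move=> c; rewrite -(law_has_law UVp) -(law_has_law XYq).
apply: eq_law => w Pw /=; have [x [-> xu]] := fP _ Pw.
have puv := has_law_neq0 UVp Pw.
by rewrite (key _ _ _ _ xu puv (lawN _ _ _ _ _ Pw))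
  (key _ _ _ _ (lawN _ _ _ _ _ Pw) puv (lawN _ _ _ _ _ Pw)).
Qed.

Definition diag_distr (T : countType) (b : distr R T) : distr R (T * T)%type :=
  push_distr b (joint id id).

Lemma S_ana_diag (C T : countType) (f : U -> C) (g : V -> C) (b : distr R T) :
  finest_pair p f g -> S_ana p (diag_distr b) ->
  exists h : C -> T, law p (h \o (f \o fst)) =1 b.
Proof.
move=> [_ fin] /S_ana_common_pair ana.
have /ana [f' [g' [fg' lf']]] : common_pair (diag_distr b) id id.
  apply/common_pairP => s t st.
  by have [w [_ [<- <-]]] := has_law_neq0_ex (has_law_push b (joint id id)) st.
have [h hf] := fin _ _ _ fg'; exists h => t.
rewrite (_ : h \o _ = f' \o fst); last by apply/funext => z /=; rewrite hf.
rewrite lf' -(law_has_law (has_law_push b (joint id id))).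
exact: law_id.
Qed.

Lemma S_hyb_diag (T : countType) (b : distr R T) :
  entropy b id <= C_GK p -> S_hyb p (diag_distr b).
Proof.
move=> bC; apply: (S_hyb_indep (has_law_push b (joint id id)) (W := id)).
  move=> s t u; rewrite /cond_law.
  have [<-|st] := eqVneq s t; last first.
    rewrite law_eq0 => [|w _ [e1 e2 _]]; last by rewrite -e1 e2 eqxx in st.
    rewrite [law b (joint id id) (s, t)]law_eq0 ?mul0r// => w _ [e1 e2].
    by rewrite -e1 e2 eqxx in st.
  have -> : law b (joint (joint id id) id) (s, s, u) =
      law b (joint id id) (s, u).
    by apply: eq_law => w _; split=> [[_ <- <-]|[<- <-]].
  have -> : law b (joint id id) (s, s) = law b id s.
    by apply: eq_law => w _; split=> [[_ <-]|<-].
  have [s0|sN] := eqVneq (law b id s) 0%R; last by field.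
  by rewrite law_joint_eq0l// s0 !mul0r.
exact: le_trans (mutual_info_le_entropy _ _ _) bC.
Qed.

End CommonPart.

Section Spike.
Variable R : realType.

Lemma fin_distr_sum1 (T : finType) (f : T -> R) : (forall t, 0 <= f t)%R ->
  (\sum_t f t = 1)%R -> \esum_(t in [set: T]) (f t)%:E = 1.
Proof. by move=> f0 f1; rewrite esum_finType// f1. Qed.

Definition fin_distr (T : finType) (f : T -> R) (f0 : forall t, (0 <= f t)%R)
    (f1 : (\sum_t f t = 1)%R) : distr R T := Distr f0 (fin_distr_sum1 f0 f1).

Lemma entropy_finType (T : finType) (b : distr R T) :
  entropy b id = (\sum_t - (b t * ln (b t)))%:E.
Proof.
rewrite /entropy -esum_finType.
  by apply: eq_esum => t _; rewrite law_id.
move=> t; rewrite oppr_ge0 mulr_ge0_le0 ?prob_of_ge0// ln_le0//.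
by rewrite -law_id law_le1.
Qed.

Section Uniform.
Variable n : nat.

Lemma uniform_ge0 (i : 'I_n.+1) : (0 <= n.+1%:R^-1 :> R)%R.
Proof. by rewrite invr_ge0. Qed.

Lemma uniform_sum1 : (\sum_(i < n.+1) n.+1%:R^-1 = 1 :> R)%R.
Proof. by rewrite sumr_const card_ord -[LHS]mulr_natr mulVf// pnatr_eq0. Qed.

Definition uniform : distr R 'I_n.+1 :=
  fin_distr uniform_ge0 uniform_sum1.

Lemma entropy_uniform : entropy uniform id = (ln (n.+1%:R : R))%:E.
Proof.
rewrite entropy_finType /= sumr_const card_ord; congr EFin.
by rewrite lnV ?posrE ?ltr0n// mulrN opprK -[LHS]mulr_natl mulrA divff ?mul1r.
Qed.

End Uniform.

(* Entropy of the law on [n + 1] points that gives mass [s] to [n] of them. *)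
Definition spike_entropy (n : nat) (s : R) : R :=
  (- ((1 - n%:R * s) * ln (1 - n%:R * s)) - n%:R * (s * ln s))%R.

Lemma spike_entropy_uniform n : spike_entropy n (n.+1%:R^-1) = ln (n.+1%:R : R).
Proof.
have n1 : (n.+1%:R : R) != 0%R by rewrite pnatr_eq0.
rewrite /spike_entropy (_ : 1 - n%:R / n.+1%:R = n.+1%:R^-1)%R; last first.
  by rewrite -natr1 in n1 *; field.
rewrite lnV ?posrE ?ltr0n//; rewrite -natr1 in n1 *; by field.
Qed.

Lemma spike_entropy_small n (r : R) : (0 < r)%R -> (r <= n.+1%:R^-1)%R ->
  (spike_entropy n (r ^+ 2) <= 2 * n%:R * r)%R.
Proof.
move=> r0 rn; have n0 : (0 <= n%:R :> R)%R := ler0n _ _.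
have r1 : (r <= 1)%R by rewrite (le_trans rn)// invf_le1 ?ltr0n// ler1n.
have nr1 : (n%:R * r < 1)%R.
  rewrite (le_lt_trans (ler_wpM2l n0 rn))//.
  by rewrite ltr_pdivrMr ?ltr0n// mul1r ltr_nat.
have y0 : (0 < 1 - n%:R * r ^+ 2)%R by nra.
have yV0 : (0 < (1 - n%:R * r ^+ 2)^-1)%R by rewrite invr_gt0.
have rV0 : (0 < r^-1)%R by rewrite invr_gt0.
have := ln_le_sub1 rV0; rewrite lnV ?posrE// => lr.
have := ln_le_sub1 yV0; rewrite lnV ?posrE// => ly.
have {}ly : (- ((1 - n%:R * r ^+ 2) * ln (1 - n%:R * r ^+ 2)) <=
    n%:R * r ^+ 2)%R.
  rewrite -mulrN (le_trans (ler_wpM2l (ltW y0) ly))//.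
  by rewrite mulrBr divff ?lt0r_neq0// mulr1 opprB addrCA subrr addr0.
have {}lr : (- (r ^+ 2 * ln (r ^+ 2)) <= 2 * (r - r ^+ 2))%R.
  have := ler_wpM2l (sqr_ge0 r) lr.
  have -> : (r ^+ 2 * (r^-1 - 1) = r - r ^+ 2)%R by field; exact: lt0r_neq0.
  by rewrite lnXn// mulrnAr mulrN; lra.
rewrite /spike_entropy; have := ler_wpM2l n0 lr; nra.
Qed.

Lemma spike_entropy_IVT n (h : R) : (0 < h)%R -> (h <= ln n.+1%:R)%R ->
  exists2 s : R, (0 < s /\ s <= n.+1%:R^-1)%R & spike_entropy n s = h.
Proof.
move=> h0 hn; have n1 : (0 < n.+1%:R :> R)%R by rewrite ltr0n.
pose b : R := (n.+1%:R^-1)%R; pose r := Num.min b (h / (2 * n.+1%:R))%R.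
have b0 : (0 < b)%R by rewrite invr_gt0.
have b1 : (b <= 1)%R by rewrite invf_le1 ?ltr0n// ler1n.
have r0 : (0 < r)%R by rewrite lt_min b0 divr_gt0// mulr_gt0.
have rb : (r <= b)%R by rewrite ge_min lexx.
have r2b : (r ^+ 2 <= b)%R by nra.
have r20 : (0 < r ^+ 2)%R by rewrite exprn_gt0.
have rh : (spike_entropy n (r ^+ 2) <= h)%R.
  apply: le_trans (spike_entropy_small r0 rb) _.
  have : (r <= h / (2 * n.+1%:R))%R by rewrite ge_min lexx orbT.
  by rewrite ler_pdivlMr ?mulr_gt0// -natr1; nra.
have cont : {within `[(r ^+ 2)%R, b], continuous (spike_entropy n)}.
  apply: continuous_in_subspaceT => s /set_mem /=.
  rewrite in_itv /= => /andP[rs sb].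
  have s0 : (0 < s)%R by exact: lt_le_trans rs.
  have ns1 : (0 < 1 - n%:R * s)%R.
    rewrite subr_gt0 (le_lt_trans (ler_wpM2l (ler0n _ _) sb))//.
    by rewrite ltr_pdivrMr// mul1r ltr_nat.
  have cns : {for s, continuous (fun x : R => 1 - n%:R * x)%R}.
    apply: cvgB; first exact: cvg_cst.
    by apply: cvgM; [exact: cvg_cst|exact: cvg_id].
  have cln : {for s, continuous (fun x : R => ln (1 - n%:R * x))%R}.
    exact: (continuous_comp cns (continuous_ln ns1)).
  apply: cvgB; first by apply: cvgN; exact: cvgM.
  apply: cvgM; first exact: cvg_cst.
  by apply: cvgM; [exact: cvg_id|exact: continuous_ln].
have [|s] := IVT (v := h) r2b cont.
  by rewrite spike_entropy_uniform ge_min rh le_max hn orbT.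
rewrite in_itv /= => /andP[rs sb] <-; exists s => //; split=> //.
exact: lt_le_trans rs.
Qed.

Lemma spike_distr n (h : R) : (0 < h)%R -> (h <= ln n.+1%:R)%R ->
  exists b : distr R 'I_n.+1, (forall i, b i != 0%R) /\ entropy b id = h%:E.
Proof.
move=> h0 hn; have [s [s0 sn] sE] := spike_entropy_IVT h0 hn.
have ns1 : (0 < 1 - n%:R * s)%R.
  rewrite subr_gt0 (le_lt_trans (ler_wpM2l (ler0n _ _) sn))//.
  by rewrite ltr_pdivrMr ?ltr0n// mul1r ltr_nat.
pose f (i : 'I_n.+1) := if i == ord0 then (1 - n%:R * s)%R else s.
have f_gt0 i : (0 < f i)%R by rewrite /f; case: ifP.
have f_sum (F : R -> R) :
    (\sum_i F (f i) = F (1 - n%:R * s) + n%:R * F s)%R.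
  rewrite big_ord_recl /f eqxx; congr (_ + _)%R.
  under eq_bigr do rewrite eq_sym (negPf (neq_lift _ _)).
  by rewrite sumr_const card_ord mulr_natl.
have f1 : (\sum_i f i = 1)%R by rewrite (f_sum id) subrK.
exists (fin_distr (fun i => ltW (f_gt0 i)) f1); split=> [i|].
  by rewrite lt0r_neq0//= f_gt0.
rewrite entropy_finType /= (f_sum (fun x => - (x * ln x)))%R -sE.
by rewrite /spike_entropy mulrN.
Qed.

End Spike.

Section PositiveCommonInformation.
Variables (R : realType) (U V : countType) (p : distr R (U * V)%type).

(* Distinct entropy-preserving functions of the finest common part would
   relabel it with different numbers of atoms. *)
Lemma hyb_not_ana : 0 < C_GK p ->
  exists (A B : countType) (q : distr R (A * B)%type), S_hyb p q /\ ~ S_ana p q.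
Proof.
move=> C0; have [f [g fin]] := finest_pair_exists p.
have [_ fE] := finest_GK_part fin.
have [Coo|Cfin] := eqVneq (C_GK p) +oo.
  have [z pz] := distr_neq0 p.
  set k := law p (f \o fst) (f z.1).
  have k0 : (0 < k)%R by exact: (law_gt0 (f \o fst) pz).
  have [n nk] : exists n, (n.+1%:R^-1 < k)%R.
    exists (Num.bound k^-1); rewrite invf_plt ?posrE ?ltr0n//.
    rewrite (lt_le_trans (archi_boundP _)) ?invr_ge0 ?ltW//.
    by rewrite ltr_nat.
  exists _, _, (diag_distr (uniform R n)); split.
    by apply: S_hyb_diag; rewrite Coo leey.
  move=> /(S_ana_diag fin) [h hE].
  have := law_comp_ge p (f \o fst) h (f z.1); rewrite hE /= -/k.
  by rewrite leNgt nk.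
have [c cE] : exists c, C_GK p = c%:E.
  by exists (fine (C_GK p)); rewrite fineK// ge0_fin_numE ?ltey// ltW.
rewrite cE lte_fin in C0.
have [n cn] : exists n, (c <= ln n.+1%:R)%R.
  exists (Num.bound (expR c)); rewrite -[c in (c <= _)%R]expRK.
  rewrite ler_ln ?posrE ?expR_gt0// ltW//.
  rewrite (lt_le_trans (archi_boundP _)) ?expR_ge0//.
  by rewrite ler_nat.
have [b [b0 bE]] := spike_distr C0 cn.
have [b' [b0' bE']] : exists b : distr R 'I_n.+2,
    (forall i, b i != 0%R) /\ entropy b id = c%:E.
  by apply: spike_distr => //; rewrite (le_trans cn)// ler_ln ?posrE// ler_nat.
have [ana|nana] := pselect (S_ana p (diag_distr b)); last first.
  by exists _, _, (diag_distr b); split=> //; apply: S_hyb_diag; rewrite bE cE.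
exists _, _, (diag_distr b'); split; first by apply: S_hyb_diag; rewrite bE' cE.
move=> ana'; have [h hE] := S_ana_diag fin ana.
have [h' hE'] := S_ana_diag fin ana'.
have h_inj := @entropy_comp_inj _ _ p _ _ (f \o fst) h.
have fE' : entropy p (f \o fst) = c%:E by rewrite -cE -fE.
have {}h_inj : forall a a', law p (f \o fst) a != 0%R ->
    law p (f \o fst) a' != 0%R -> h a = h a' -> a = a'.
  apply: h_inj; rewrite fE' ?ltry// -bE.
  by apply: le_esum => i _; rewrite hE law_id.
have /choice [k kP] (j : 'I_n.+2) :
    exists a, law p (f \o fst) a != 0%R /\ h' a = j.
  have : law p (h' \o (f \o fst)) j != 0%R by rewrite hE'.
  move=> /law_neq0 [z [pz zj]]; exists (f z.1); split=> //.
  by rewrite lt0r_neq0// (law_gt0 (f \o fst) pz).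
suff /leq_card : injective (h \o k) by rewrite !card_ord ltnn.
move=> i j /= hkij.
have [ki <-] := kP i; have [kj <-] := kP j.
by congr h'; exact: h_inj.
Qed.

End PositiveCommonInformation.

(* With no common information the pair [(X, Y)] is independent of [W], so
   conditioning on one value of [W] changes neither the law of [(U, V)] nor
   that of [(X, Y)] and leaves an analog scheme. *)
Lemma hyb_sub_ana (R : realType) (U V : countType) (p : distr R (U * V)%type) :
  C_GK p = 0 -> csub (S_hyb p) (S_ana p).
Proof.
move=> C0 A B q [C [f [g [[_ fE] [Om [P [D [U' [V' [W [X [Y]]]]]]]]]]]].
set K := fun w => f (U' w); move=> [UVp XYq WKUV XUVY Ile].
have HK : entropy P K = 0 by rewrite -C0 -fE -(entropy_has_law UVp).
have [w1 Pw1] := distr_neq0 P.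
have K1 : law P K (K w1) = 1%R.
  rewrite entropyE in HK.
  have := expect_eq0 (P := P) (f := fun w => (- ln (law P K (K w)))%R).
  move=> /(_ _ _ w1 Pw1) h; apply/eqP; rewrite -ln_eq0 ?law_gt0//.
  rewrite -oppr_eq0 h// ?HK// => w _.
  by rewrite oppr_ge0 ln_le0// law_le1.
have Kae w : P w != 0%R -> K w = K w1.
  move=> Pw; have /Pr_eq1 : Pr P (K @^-1` [set K w1]) = 1 by rewrite -lawE K1.
  by apply.
pose d := W w1.
have Wd : law P W d != 0%R by rewrite lt0r_neq0// law_gt0.
rewrite C0 in Ile; have ind := mutual_info_indep Ile.
exists Om, (cond_distr Wd), U', V', X, Y; split.
- move=> z; rewrite law_cond.
  have := WKUV d (K w1) z; rewrite /cond_law K1 divr1.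
  have -> : law P (joint (joint W K) (joint U' V')) (d, K w1, z) =
      law P (joint (joint U' V') W) (z, d).
    by apply: eq_law => w /Kae; rewrite /joint => ->; split=> [[-> <-]|[<- ->]].
  have -> : law P (joint W K) (d, K w1) = law P W d.
    by apply: eq_law => w /Kae; rewrite /joint => ->; split=> [[->]|->].
  have -> : law P (joint K (joint U' V')) (K w1, z) = law P (joint U' V') z.
    by apply: eq_law => w /Kae; rewrite /joint => ->; split=> [[<-]|<-].
  by rewrite UVp => ->; rewrite mulrC mulKf.
- move=> z; rewrite law_cond.
  have -> : law P (joint (joint X Y) W) (z, d) =
      law P (joint (joint X Y) (joint K W)) (z, (K w1, d)).
    by apply: eq_law => w /Kae; rewrite /joint => ->; split=> [[<- ->]|[<- ->]].
  rewrite ind XYq.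
  have -> : law P (joint K W) (K w1, d) = law P W d.
    by apply: eq_law => w /Kae; rewrite /joint => ->; split=> [[->]|->].
  by rewrite mulfK.
- move=> x u v y; rewrite /cond_law !law_cond.
  have -> : law P (joint (joint (joint (joint X U') V') Y) W) (x, u, v, y, d) =
      law P (joint (joint (joint X (joint U' W)) (joint V' W)) Y)
        (x, (u, d), (v, d), y).
    by apply: eq_law => w _; split=> [[<- <- <- <- <-]|[<- <- <- <- _ <-]].
  rewrite XUVY /cond_law.
  have -> : law P (joint X (joint U' W)) (x, (u, d)) =
      law P (joint (joint X U') W) (x, u, d).
    by apply: eq_law => w _; split=> [[<- <- <-]|[<- <- <-]].
  have -> : law P (joint (joint U' W) (joint V' W)) ((u, d), (v, d)) =
      law P (joint (joint U' V') W) (u, v, d).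
    by apply: eq_law => w _; split=> [[<- <- <-]|[<- <- <-]].
  have -> : law P (joint (joint V' W) Y) ((v, d), y) =
      law P (joint (joint V' Y) W) (v, y, d).
    by apply: eq_law => w _; split=> [[<- <- <-]|[<- <- <-]].
  have divd (s t : R) : (s / law P W d / (t / law P W d) = s / t)%R.
    by rewrite invf_div mulrA divfK.
  by rewrite !divd; ring.
Qed.

Section StrictUnion.
Variable R : realType.

Definition offdiag (z : 'I_3 * 'I_3) : R :=
  if z.1 == z.2 then 0%R else 6%:R^-1%R.

Lemma offdiag_ge0 z : (0 <= offdiag z)%R.
Proof. by rewrite /offdiag; case: ifP. Qed.

Lemma offdiag_row (u : 'I_3) : (\sum_v offdiag (u, v) = 3%:R^-1)%R.
Proof.
rewrite !big_ord_recl big_ord0 /offdiag /=.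
by case: u => -[|[|[|]]] //= i; field.
Qed.

Lemma offdiag_sum1 : (\sum_z offdiag z = 1)%R.
Proof.
rewrite -(pair_bigA _ (fun u v => offdiag (u, v))) /=.
under eq_bigr do rewrite offdiag_row.
by rewrite sumr_const card_ord -[LHS]mulr_natr mulVf.
Qed.

Definition offdiag_distr : distr R ('I_3 * 'I_3)%type :=
  fin_distr offdiag_ge0 offdiag_sum1.

Definition share (z : 'I_2 * ('I_3 * 'I_3)) : ('I_2 * 'I_3) * ('I_2 * 'I_3) :=
  ((z.1, z.2.1), (z.1, z.2.2)).

Definition uv_distr : distr R (('I_2 * 'I_3) * ('I_2 * 'I_3))%type :=
  push_distr (prod_distr (uniform R 1) offdiag_distr) share.

Lemma uv_distr_neq0 k u v : u != v -> uv_distr ((k, u), (k, v)) != 0%R.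
Proof.
move=> uv; rewrite -(has_law_push _ share).
rewrite (@eq_law _ _ _ _ _ _ id _ (k, (u, v))) => [|[? [? ?]] _]; last first.
  by rewrite /share /=; split=> [[-> -> _ ->]|[-> -> ->]].
rewrite law_id /= /offdiag /= (negPf uv) mulf_neq0// invr_neq0// pnatr_eq0.
Qed.

Lemma finest_uv : finest_pair uv_distr fst fst.
Proof.
split.
  apply/common_pairP => x y xy.
  by have [z [_ [<- <-]]] := has_law_neq0_ex (has_law_push _ share) xy.
move=> C f g /common_pairP fg; exists (fun k => f (k, ord0)) => -[k u] /=.
have [v [uv v0]] : exists v : 'I_3, u != v /\ ord0 != v.
  case: (eqVneq u (inord 1)) => [->|u1].
    by exists (inord 2); rewrite -!val_eqE /= !inordK.
  by exists (inord 1); rewrite u1 -val_eqE /= inordK.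
by rewrite (fg _ _ (uv_distr_neq0 k uv)) (fg _ _ (uv_distr_neq0 k v0)).
Qed.

Lemma C_GK_uv : C_GK uv_distr = (ln (2%:R : R))%:E.
Proof.
have [_ <-] := finest_GK_part finest_uv; rewrite -entropy_uniform.
rewrite -(entropy_has_law (has_law_push _ share)).
apply: eq_esum => k _.
by rewrite -(law_prod_fst (uniform R 1) offdiag_distr id).
Qed.

Variable b : distr R 'I_3.
Hypothesis b0 : forall i, b i != 0%R.
Hypothesis bE : entropy b id = (ln (2%:R : R))%:E.

Let T := ('I_3 * 'I_3 * 'I_3)%type.
Let Q := prod_distr offdiag_distr b.
Let P := prod_distr (uniform R 1) Q.
Let W (z : T) := z.2.
Let X (z : T) := (z.2, z.1.1).
Let Y (z : T) := (z.2, z.1.2).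

Definition xy_distr : distr R (('I_3 * 'I_3) * ('I_3 * 'I_3))%type :=
  push_distr Q (joint X Y).

Let law_W : has_law Q W b.
Proof. by move=> w; rewrite -law_id -(law_prod_snd offdiag_distr b id). Qed.

Lemma S_hyb_xy : S_hyb uv_distr xy_distr.
Proof.
exists 'I_2, fst, fst; split; first exact: finest_GK_part finest_uv.
pose KT (z : 'I_2 * T) := (z.1, z.2.1).
have KTl : has_law P KT (prod_distr (uniform R 1) offdiag_distr).
  move=> [k t];
  transitivity (law P (joint (id \o fst) ((id \o fst) \o snd)) (k, t)) => //.
  by rewrite law_prod law_prod_fst !law_id.
exists ('I_2 * T)%type, P, 'I_3, (fun z => (z.1, z.2.1.1)),
  (fun z => (z.1, z.2.1.2)), (W \o snd), (X \o snd), (Y \o snd); split.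
- by move=> z; exact: (law_has_law KTl share).
- by move=> z; exact: (law_prod_snd (uniform R 1) Q (joint X Y)).
- apply: (@markov3_indep _ _ P _ _ _ (W \o snd) (share \o KT) (fst \o fst)).
  apply: (@law_indep_comp _ _ P _ _ _ _ (W \o snd) KT id share) => w [k t].
  have -> : law P (W \o snd) w = b w.
    by rewrite law_prod_snd law_W.
  rewrite KTl.
  rewrite (@eq_law _ _ _ _ _ _ (joint (id \o fst) (id \o snd)) _ (k, (t, w))).
    by rewrite law_prod !law_id /=; ring.
  by move=> [? [? ?]] _; split=> [[<- <- <-]|[<- <- <-]].
- exact: (@markov4_det _ _ _ _ _ _ P (fun z => ((z.1, z.2.1.1), z.2.2))
    (fun z => ((z.1, z.2.1.2), z.2.2)) (fun x => (x.2, x.1.2))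
    (fun y => (y.2, y.1.2))).
- rewrite (mutual_info_prod (uniform R 1) Q (joint X Y) id W) C_GK_uv -bE.
  apply: le_trans (mutual_info_le_entropy _ _ _) _.
  by rewrite -(entropy_has_law law_W id).
Qed.

Lemma S_ana_xy : ~ S_ana uv_distr xy_distr.
Proof.
move=> /S_ana_common_pair ana.
have XYl := has_law_push Q (joint X Y).
have /ana [f [g [fg lf]]] : common_pair xy_distr fst fst.
  apply/common_pairP => x y xy.
  by have [z [_ [<- <-]]] := has_law_neq0_ex XYl xy.
have [h hE] := finest_uv.2 _ _ _ fg.
have /choice [k kP] (w : 'I_3) : exists k, h k = w.
  have : law uv_distr (f \o fst) w != 0%R.
    by rewrite lf -(law_has_law XYl) [law _ _ w]law_W.
  by move=> /law_neq0 [z [_ <-]]; exists z.1.1; rewrite /= hE.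
have /leq_card : injective k by apply: (can_inj kP).
by rewrite !card_ord.
Qed.

Lemma law_X w u : law Q X (w, u) = (b w / 3%:R)%R.
Proof.
rewrite (@eq_law _ _ _ _ _ _ (joint (fst \o fst) (id \o snd)) _ (u, w)).
  rewrite law_prod law_id mulrC; congr (_ * _)%R; apply: EFin_inj.
  rewrite -(law_joint_marginal _ _ snd) -(offdiag_row u) -esum_finType//.
    apply: eq_esum => v _; rewrite -[offdiag _](law_id offdiag_distr).
    by congr EFin; apply: eq_law => -[].
  by move=> v; exact: offdiag_ge0.
by move=> [[? ?] ?] _; split=> [[<- <-]|[<- <-]].
Qed.

Lemma law_Y w v : law Q Y (w, v) = (b w / 3%:R)%R.
Proof.
rewrite (@eq_law _ _ _ _ _ _ (joint (snd \o fst) (id \o snd)) _ (v, w)).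
  rewrite law_prod law_id mulrC; congr (_ * _)%R; apply: EFin_inj.
  rewrite -(law_joint_marginalr _ fst) -(offdiag_row v) -esum_finType//.
    apply: eq_esum => u _; congr EFin.
    transitivity (law offdiag_distr id (u, v)); first by apply: eq_law => -[].
    by rewrite law_id /= /offdiag eq_sym.
  by move=> u; exact: offdiag_ge0.
by move=> [[? ?] ?] _; split=> [[<- <-]|[<- <-]].
Qed.

(* [I(X;Y) = H(b) + ln (3/2)], which exceeds the common information of
   [(U, V)] and bounds the Wyner common information from below. *)
Lemma S_dig_xy : ~ S_dig uv_distr xy_distr.
Proof.
move=> [_ [[[Om [P' [D [X' [Y' [W' [XYq XWY ->]]]]]]] _]]].
apply/negP; rewrite -ltNge.
have XYl := has_law_push Q (joint X Y).
have lX (x : 'I_3 * 'I_3) : law P' X' x = law Q X x.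
  by rewrite -[X']/(fst \o joint X' Y') (law_has_law XYq) -(law_has_law XYl).
have lY (y : 'I_3 * 'I_3) : law P' Y' y = law Q Y y.
  by rewrite -[Y']/(snd \o joint X' Y') (law_has_law XYq) -(law_has_law XYl).
have b_gt0 w : (0 < b w)%R by rewrite lt0r b0 prob_of_ge0.
have b_le1 w : (b w <= 1)%R by rewrite -law_id law_le1.
have ln32 : (0 < ln (3 / 2) :> R)%R by rewrite ln_gt0//; lra.
pose F (z : ('I_3 * 'I_3) * ('I_3 * 'I_3)) := (- ln (b z.1.1) + ln (3 / 2))%R.
have F0 z : (0 <= F z)%R.
  by rewrite addr_ge0 ?(ltW ln32)// oppr_ge0 ln_le0.
apply: lt_le_trans (mutual_info_markov3_ge XWY F0 _); last first.
  move=> x y; rewrite XYq lX lY => xy.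
  have [[[u v] w] [Pz [<- <-]]] := has_law_neq0_ex XYl xy.
  rewrite law_X law_Y /F /=.
  rewrite (@eq_law _ _ _ _ _ _ id _ ((u, v), w)); last first.
    by move=> [[? ?] ?] _; split=> [[<- <- _ <-]|[<- <- <-]].
  rewrite law_id /=; move: Pz; rewrite /= /offdiag /=.
  case: (eqVneq u v) => [_|_ _]; first by rewrite mul0r eqxx.
  rewrite [X in (_ <= ln X)%R](_ : _ = (b w)^-1 * (3 / 2))%R; last first.
    by field; rewrite b0.
  rewrite [leRHS]lnM ?posrE ?invr_gt0 ?divr_gt0//.
  by rewrite [X in (_ <= X + _)%R]lnV ?posrE.
rewrite (expect_has_law XYq F0) -(expect_has_law XYl F0) C_GK_uv -bE.
rewrite expectD => [|z|z]; last 2 first.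
- by rewrite oppr_ge0 ln_le0.
- exact: ltW.
rewrite expect_cst ?ltW// (_ : expect _ _ = entropy b id); last first.
  rewrite -(entropy_has_law law_W id) entropyE.
  by apply: eq_expect => z _; rewrite law_W.
by rewrite bE -EFinD lte_fin ltrDl.
Qed.

End StrictUnion.

Theorem proposition3 (R : realType) :
  (forall (U V : countType) (p : distr R (U * V)%type),
     csub (cunion (S_dig p) (S_ana p)) (S_hyb p)) /\
  (exists (U V : countType) (p : distr R (U * V)%type),
     cproper (cunion (S_dig p) (S_ana p)) (S_hyb p)) /\
  (forall (U V : countType) (p : distr R (U * V)%type),
     cproper (S_ana p) (S_hyb p) <-> (0 < C_GK p)%E).
Proof.
have union_sub (U V : countType) (p : distr R (U * V)%type) :
    csub (cunion (S_dig p) (S_ana p)) (S_hyb p).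
  by move=> A B q []; [exact: S_dig_sub_hyb|exact: S_ana_sub_hyb].
split=> //; split.
  have [b [b0 bE]] : exists b : distr R 'I_3,
      (forall i, b i != 0%R) /\ entropy b id = (ln (2%:R : R))%:E.
    by apply: spike_distr; rewrite ?ln_gt0 ?ltr1n// ler_ln ?posrE// ler_nat.
  exists _, _, (uv_distr R); split; first exact: union_sub.
  exists _, _, (xy_distr b); split; first exact: S_hyb_xy.
  by move=> []; [exact: S_dig_xy|exact: S_ana_xy].
move=> U V p; split=> [[_ [A [B [q [hyb nana]]]]]|C0].
  rewrite lt_neqAle C_GK_ge0 andbT; apply/eqP => /esym C0.
  exact/nana/hyb_sub_ana.
split; first exact: S_ana_sub_hyb.
exact: hyb_not_ana.
Qed.
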